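(* Let $U,V\in\mathcal{G}(X)$. (i) If $V\approx w\in\mathcal{D}'(X)$, $f\in C^\infty(X)$, and either (a) $U=\sigma(f)$ or (b) $U\approx_\infty f$, then $UV\approx fw$. (ii) If $U\approx_k f$ and $V\approx_k g$, then $UV\approx_k fg$ (where $f,g\in C^k(X)$, $0\le k\le\infty$).
   Context: $\mathbb{K}$ denotes $\mathbb{R}$ or $\mathbb{C}$; $X$ is a paracompact smooth Hausdorff manifold of dimension $n$; functions are $\mathbb{K}$-valued; $I=(0,1]$; $\mathcal{P}(X)$ is the space of linear differential operators $C^\infty(X)\to C^\infty(X)$. $\mathcal{E}_M(X)$ is the set of $(u_\varepsilon)_\varepsilon\in C^\infty(X)^I$ such that for every compact $L\subset X$ and $P\in\mathcal{P}(X)$ there is $N\in\mathbb{N}$ with $\sup_{p\in L}|Pu_\varepsilon(p)|=O(\varepsilon^{-N})$ as $\varepsilon\to0$; $\mathcal{N}(X)$ is the set of those nets such that for all compact $L\subset X$, $P\in\mathcal{P}(X)$, $m\in\mathbb{N}$, $\sup_{p\in L}|Pu_\varepsilon(p)|=O(\varepsilon^{m})$. $\mathcal{G}(X)=\mathcal{E}_M(X)/\mathcal{N}(X)$ is an algebra with componentwise operations. $\sigma:C^\infty(X)\to\mathcal{G}(X)$, $\sigma(f)=\mathrm{cl}[(f)_\varepsilon]$. $\mathcal{D}'(X)$ is the topological dual of the space $\Gamma_c(X,\mathrm{Vol}(X))$ of compactly supported smooth one-densities, and $(fw)(\mu)=w(f\mu)$. For $U=\mathrm{cl}[(u_\varepsilon)_\varepsilon]\in\mathcal{G}(X)$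 and $w\in\mathcal{D}'(X)$, $U\approx w$ means $\int_X u_\varepsilon\mu\to w(\mu)$ as $\varepsilon\to0$ for all $\mu\in\Gamma_c(X,\mathrm{Vol}(X))$. For $0\le k\le\infty$ and a function $f\in C^k(X)$, $U\approx_k f$ ($U$ admits $f$ as $C^k$-associated function) means: for all finite $l\le k$, all smooth vector fields $\xi_1,\dots,\xi_l$ on $X$ and one (hence any) representative $(u_\varepsilon)_\varepsilon$ of $U$, $L_{\xi_1}\cdots L_{\xi_l}(u_\varepsilon-f)\to 0$ uniformly on compact sets as $\varepsilon\to 0$ ($L_\xi$ is the Lie derivative). *)

(* Defs.v *)
From HB Require Import structures.
From mathcomp Require Import all_boot all_order all_algebra.
From mathcomp Require Import all_classical all_reals all_analysis.
From mathcomp.real_closed Require Import complex.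

Set Implicit Arguments.
Unset Strict Implicit.
Unset Printing Implicit Defensive.
Import Order.TTheory GRing.Theory Num.Theory.
Import numFieldNormedType.Exports.
Local Open Scope classical_set_scope.
Local Open Scope ring_scope.

Variant scalar_kind := real_scalars | complex_scalars.

Definition scalars (R : realType) (k : scalar_kind) : numFieldType :=
  match k with
  | real_scalars => R : numFieldType
  | complex_scalars => R[i] : numFieldType
  end.

Definition kre (R : realType) (k : scalar_kind) : scalars R k -> R :=
  match k return scalars R k -> R with
  | real_scalars => fun x => x
  | complex_scalars => fun z => complex.Re z
  end.

Definition kim (R : realType) (k : scalar_kind) : scalars R k -> R :=
  match k return scalars R k -> R with
  | real_scalars => fun=> 0
  | complex_scalars => fun z => complex.Im z
  end.

(* [a + i b]; over the reals the imaginary part is dropped. *)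
Definition kpair (R : realType) (k : scalar_kind) (a b : R) : scalars R k :=
  match k return scalars R k with
  | real_scalars => a
  | complex_scalars => Complex a b
  end.

(* [`|x|] lives in [scalars R k]; this is the same number in [R]. *)
Definition kabs (R : realType) (k : scalar_kind) (x : scalars R k) : R :=
  kre `|x|.

(* An order of differentiability: [Some m] is m, [None] is infinity. *)
Definition order_le (m : nat) (k : option nat) : Prop :=
  if k is Some k' then (m <= k')%N else True.

Section Euclidean.
Context {R : realType} {n : nat}.
Implicit Types (O : set 'rV[R]_n).

(* C^m for a finite m, by iterated partial derivatives; [O] is meant open *)
Fixpoint Cm_on (m : nat) O (g : 'rV[R]_n -> R) : Prop :=
  (forall y, O y -> {for y, continuous g}) /\
  (if m is m'.+1 then
     forall i : 'I_n, (forall y, O y -> derivable g y (delta_mx 0 i)) /\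
                      Cm_on m' O (fun y => 'D_(delta_mx 0 i) g y)
   else True).

Definition Ck_on (k : option nat) O (g : 'rV[R]_n -> R) : Prop :=
  forall m, order_le m k -> Cm_on m O g.

Context {s : scalar_kind}.
Local Notation K := (scalars R s).

Definition CkK_on (k : option nat) O (g : 'rV[R]_n -> K) : Prop :=
  Ck_on k O (@kre R s \o g) /\ Ck_on k O (@kim R s \o g).

Definition kderive (v : 'rV[R]_n) (g : 'rV[R]_n -> K) : 'rV[R]_n -> K :=
  fun y => kpair s ('D_v (@kre R s \o g) y) ('D_v (@kim R s \o g) y).

Definition kpartials (I : seq 'I_n) (g : 'rV[R]_n -> K) : 'rV[R]_n -> K :=
  foldr (fun i => kderive (delta_mx 0 i)) g I.

End Euclidean.

(* Integration over R^n as an iterated Lebesgue integral. It is only applied to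
   continuous compactly supported functions, for which it agrees with the
   integral against n-dimensional Lebesgue measure by Fubini's theorem. *)
Fixpoint integral_rV (R : realType) (n : nat) : ('rV[R]_n -> R) -> R :=
  match n return ('rV[R]_n -> R) -> R with
  | 0 => fun g => g 0
  | m.+1 => fun g =>
      \int[lebesgue_measure]_(t in [set: R])
         integral_rV (fun y : 'rV[R]_m => g (row_mx (const_mx t : 'rV[R]_1) y))
  end.

Definition kintegral (R : realType) (s : scalar_kind) (n : nat)
    (g : 'rV[R]_n -> scalars R s) : scalars R s :=
  kpair s (integral_rV (@kre R s \o g)) (integral_rV (@kim R s \o g)).

Definition locally_finite (X : topologicalType) (J : Type) (D : set J)
    (F : J -> set X) : Prop :=
  forall x : X, exists2 W, nbhs x W &
    finite_set [set j | D j /\ (F j `&` W) !=set0].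

Definition paracompact (X : topologicalType) : Prop :=
  forall U : set (set X), U `<=` open -> \bigcup_(A in U) A = setT ->
  exists V : set (set X), [/\ V `<=` open, \bigcup_(B in V) B = setT,
    forall B, V B -> exists2 A, U A & B `<=` A & locally_finite V id].

Record chart (R : realType) (n : nat) (X : topologicalType) := Chart {
  chart_dom : set X ;
  chart_map :> X -> 'rV[R]_n ;
  chart_inv : 'rV[R]_n -> X ;
  chart_dom_open : open chart_dom ;
  chart_img_open : open (chart_map @` chart_dom) ;
  chart_mapK : forall p, chart_dom p -> chart_inv (chart_map p) = p ;
  chart_map_continuous : forall p, chart_dom p -> {for p, continuous chart_map} ;
  chart_inv_continuous : forall y, (chart_map @` chart_dom) y ->
    {for y, continuous chart_inv}
}.

Definition chart_img (R : realType) (n : nat) (X : topologicalType)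
  (c : chart R n X) : set 'rV[R]_n := c @` chart_dom c.

Lemma open_chart_img (R : realType) (n : nat) (X : topologicalType)
  (c : chart R n X) : open (chart_img c).
Proof. exact: (@chart_img_open _ _ _ c). Qed.
Arguments open_chart_img {R n X} c : rename.

(* Paracompact Hausdorff smooth manifolds of dimension n. The smooth structure
   is presented by an atlas which need not be maximal. [chart_at p] is a
   distinguished chart of the atlas around [p]; it serves to identify the
   fibres at [p] of the tangent and density bundles with R^n and K. *)
Record manifold (R : realType) (n : nat) := Manifold {
  space :> topologicalType ;
  atlas : set (chart R n space) ;
  chart_at : space -> chart R n space ;
  atlas_chart_at : forall p, atlas (chart_at p) ;
  chart_at_dom : forall p, chart_dom (chart_at p) p ;
  transition_smooth : forall c d, atlas c -> atlas d -> forall i : 'I_n,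
    Ck_on None (c @` (chart_dom c `&` chart_dom d))
      (fun y => d (chart_inv c y) 0 i) ;
  manifold_hausdorff : hausdorff_space space ;
  manifold_paracompact : paracompact space
}.

Section CkClosure.
Context {R : realType} {n : nat}.
Implicit Types (O : set 'rV[R]_n) (f g : 'rV[R]_n -> R).

Lemma Cm_on_eq m O f g : open O -> (forall y, O y -> f y = g y) ->
  Cm_on m O f -> Cm_on m O g.
Proof.
move=> oO.
have nearO y (h1 h2 : 'rV[R]_n -> R) :
    (forall z, O z -> h1 z = h2 z) -> O y -> {near y, h1 =1 h2}.
  move=> h12 Oy; have : nbhs y O by exact: open_nbhs_nbhs.
  by apply: filterS.
have ceq (h1 h2 : 'rV[R]_n -> R) : (forall z, O z -> h1 z = h2 z) ->
    (forall y, O y -> {for y, continuous h1}) ->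
    forall y, O y -> {for y, continuous h2}.
  move=> h12 ch y Oy; rewrite /prop_for /continuous_at -(h12 _ Oy).
  apply: cvg_trans (ch _ Oy); apply: near_eq_cvg; first exact: nbhs_filter.
  exact: (nearO y h1 h2 h12 Oy).
elim: m f g => [|m IH] f g fg /= [cf df]; split=> //; try exact: ceq cf.
move=> i; have [dfi Cf] := df i; split.
  by move=> y Oy; apply: near_eq_derivable (dfi _ Oy); exact: nearO.
by apply: IH Cf => y Oy; apply: near_eq_derive; exact: nearO.
Qed.

Lemma Cm_on_pred m O f : Cm_on m.+1 O f -> Cm_on m O f.
Proof.
elim: m f => [|m IH] f; first by case.
move=> [cf df]; split=> // i; have [dfi Cf] := df i.
by split=> //; exact: IH.
Qed.

Lemma Cm_on_cst m O (a : R) : open O -> Cm_on m O (fun=> a).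
Proof.
move=> oO; elim: m a => [|m IH] a; split=> //;
  try by move=> y _; exact: cst_continuous.
move=> i; split; first by move=> y _; exact: derivable_cst.
apply: Cm_on_eq (IH 0) => // y _; exact/esym/derive_cst.
Qed.

Lemma Cm_on_add m O f g : open O ->
  Cm_on m O f -> Cm_on m O g -> Cm_on m O (fun y => f y + g y).
Proof.
move=> oO; elim: m f g => [|m IH] f g [cf df] [cg dg]; split=> //;
  try by move=> y Oy; apply: (@continuousD _ _ _ f g); [exact: cf|exact: cg].
move=> i; have [dfi Cf] := df i; have [dgi Cg] := dg i; split.
  by move=> y Oy; apply: derivableD; [exact: dfi|exact: dgi].
apply: Cm_on_eq (IH _ _ Cf Cg) => // y Oy.
by rewrite -deriveD//; [exact: dfi|exact: dgi].
Qed.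

Lemma Cm_on_mul m O f g : open O ->
  Cm_on m O f -> Cm_on m O g -> Cm_on m O (fun y => f y * g y).
Proof.
move=> oO; elim: m f g => [|m IH] f g Cf0 Cg0;
  have [cf df] := Cf0; have [cg dg] := Cg0; split=> //;
  try by move=> y Oy; apply: (@continuousM _ _ f g); [exact: cf|exact: cg].
move=> i; have [dfi Cf] := df i; have [dgi Cg] := dg i; split.
  by move=> y Oy; apply: derivableM; [exact: dfi|exact: dgi].
have := Cm_on_add oO (IH _ _ (Cm_on_pred Cf0) Cg) (IH _ _ (Cm_on_pred Cg0) Cf).
apply: Cm_on_eq => // y Oy.
by rewrite (deriveM (dfi _ Oy) (dgi _ Oy)).
Qed.

Context {s : scalar_kind}.
Local Notation K := (scalars R s).

Lemma kreD (a b : K) : kre (a + b) = kre a + kre b.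
Proof. by move: a b; case: s => // -[? ?] [? ?]. Qed.

Lemma kimD (a b : K) : kim (a + b) = kim a + kim b.
Proof. by move: a b; case: s => [? ?|[? ?] [? ?]] //=; rewrite addr0. Qed.

Lemma kreM (a b : K) : kre (a * b) = kre a * kre b + -1 * (kim a * kim b).
Proof.
move: a b; case: s => [a b|[? ?] [? ?]] /=; first by rewrite mul0r mulr0 addr0.
by rewrite mulN1r.
Qed.

Lemma kimM (a b : K) : kim (a * b) = kre a * kim b + kim a * kre b.
Proof.
by move: a b; case: s => [a b|[? ?] [? ?]] //=; rewrite mulr0 mul0r addr0.
Qed.

Lemma CkK_on_cst k O (a : K) : open O -> CkK_on k O (fun=> a).
Proof. by move=> oO; split=> m _; exact: Cm_on_cst. Qed.

Lemma CkK_on_add k O (f g : 'rV[R]_n -> K) : open O ->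
  CkK_on k O f -> CkK_on k O g -> CkK_on k O (fun y => f y + g y).
Proof.
move=> oO [rf jf] [rg jg]; split=> m mk.
  have := Cm_on_add oO (rf m mk) (rg m mk).
  by apply: Cm_on_eq => // y _ /=; rewrite kreD.
have := Cm_on_add oO (jf m mk) (jg m mk).
by apply: Cm_on_eq => // y _ /=; rewrite kimD.
Qed.

Lemma CkK_on_mul k O (f g : 'rV[R]_n -> K) : open O ->
  CkK_on k O f -> CkK_on k O g -> CkK_on k O (fun y => f y * g y).
Proof.
move=> oO [rf jf] [rg jg]; split=> m mk.
  have := Cm_on_add oO (Cm_on_mul oO (rf m mk) (rg m mk))
    (Cm_on_mul oO (Cm_on_cst m (-1) oO) (Cm_on_mul oO (jf m mk) (jg m mk))).
  by apply: Cm_on_eq => // y _ /=; rewrite kreM.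
have := Cm_on_add oO (Cm_on_mul oO (rf m mk) (jg m mk))
  (Cm_on_mul oO (jf m mk) (rg m mk)).
by apply: Cm_on_eq => // y _ /=; rewrite kimM.
Qed.

End CkClosure.

Section Objects.
Context {R : realType} (s : scalar_kind) {n : nat} (X : manifold R n).
Local Notation K := (scalars R s).

Definition Ck (k : option nat) (f : X -> K) : Prop :=
  forall c, atlas c -> CkK_on k (chart_img c) (f \o chart_inv c).

Definition smooth_functions : {pred X -> K^o} := [pred f | `[< Ck None f >]].

Lemma smooth_functions_submod : submod_closed smooth_functions.
Proof.
split.
  by apply/asboolP => c _; exact: (CkK_on_cst None (0 : K) (open_chart_img c)).
move=> a u v /asboolP su /asboolP sv; apply/asboolP => c ac.
have oc := open_chart_img c.
exact: (CkK_on_add oc (CkK_on_mul oc (CkK_on_cst _ a oc) (su c ac)) (sv c ac)).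
Qed.

Lemma smooth_functions_mulr : mulr_closed smooth_functions.
Proof.
split.
  by apply/asboolP => c _; exact: (CkK_on_cst None (1 : K) (open_chart_img c)).
move=> u v /asboolP su /asboolP sv; apply/asboolP => c ac.
exact: (CkK_on_mul (open_chart_img c) (su c ac) (sv c ac)).
Qed.

HB.instance Definition _ :=
  GRing.isSubmodClosed.Build K (X -> K^o) smooth_functions
    smooth_functions_submod.
HB.instance Definition _ :=
  GRing.isMulClosed.Build (X -> K^o) smooth_functions smooth_functions_mulr.

Record Cinf := MkCinf {
  Cinf_fun :> X -> K^o ;
  Cinf_smooth : Cinf_fun \in smooth_functions
}.
HB.instance Definition _ := [isSub for Cinf_fun].
HB.instance Definition _ := [Choice of Cinf by <:].
HB.instance Definition _ := [SubChoice_isSubZmodule of Cinf by <:].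
HB.instance Definition _ := [SubZmodule_isSubLmodule of Cinf by <:].
HB.instance Definition _ :=
  GRing.SubZmodule_isSubPzRing.Build _ _ Cinf (subringClosedP _).
HB.instance Definition _ := GRing.SubPzRing_isSubComPzRing.Build _ _ Cinf.

(* Smooth (real) vector fields; [vf_fun p] is the vector at [p], expressed in
   the chart [chart_at p], and [vf_coord c xi p] are its components in [c]. *)
Definition vf_coord (c : chart R n X) (xi : X -> 'rV[R]_n) (p : X) : 'rV[R]_n :=
  ('D_(xi p) (c \o chart_inv (chart_at p))) (chart_at p p).

Record vector_field := VectorField {
  vf_fun :> X -> 'rV[R]_n ;
  vf_smooth : forall c, atlas c -> forall i : 'I_n,
    Ck_on None (chart_img c) (fun y => vf_coord c vf_fun (chart_inv c y) 0 i)
}.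

Definition lie (xi : vector_field) (f : X -> K) : X -> K :=
  fun p => kderive (xi p) (f \o chart_inv (chart_at p)) (chart_at p p).

(* K-valued one-densities: [mu p] is the coefficient at [p] with respect to the
   chart [chart_at p], and [dens_coord c mu p] the one with respect to [c]. *)
Definition dens_coord (c : chart R n X) (mu : X -> K) (p : X) : K :=
  kpair s `|\det ('J (chart_at p \o chart_inv c) (c p))| 0 * mu p.

Definition smooth_density (mu : X -> K) : Prop :=
  forall c, atlas c -> CkK_on None (chart_img c) (dens_coord c mu \o chart_inv c).

Definition supp (A : zmodType) (mu : X -> A) : set X :=
  closure [set p | mu p != 0].

Definition test_densities : {pred X -> K^o} :=
  [pred mu | `[< smooth_density mu /\ compact (supp mu) >]].

Lemma compact_suppS (mu nu : X -> K^o) : (forall p, mu p = 0 -> nu p = 0) ->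
  compact (supp mu) -> compact (supp nu).
Proof.
move=> mu0 cmu; apply: (subclosed_compact (@closed_closure _ _) cmu).
apply: closure_subset => p /=; apply: contra_neq; exact: mu0.
Qed.

Lemma test_densities_submod : submod_closed test_densities.
Proof.
split.
  apply/asboolP; split=> [c _|].
    have oc := open_chart_img c; have [] := CkK_on_cst None (0 : K) oc => h1 h2.
    by split=> m mk; [have := h1 m mk|have := h2 m mk];
      apply: Cm_on_eq => // y _; rewrite /= /dens_coord mulr0.
  rewrite /supp (_ : [set _ | _] = set0) ?closure0 ?closed0; first exact: compact0.
  by apply/seteqP; split=> p //=; rewrite eqxx.
move=> a mu nu /asboolP[smu cmu] /asboolP[snu cnu]; apply/asboolP; split.
  move=> c ac; have oc := open_chart_img c.
  have := CkK_on_add oc (CkK_on_mul oc (CkK_on_cst _ a oc) (smu c ac)) (snu c ac).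
  case=> h1 h2; split=> m mk; [have := h1 m mk|have := h2 m mk];
    apply: Cm_on_eq => // y _ /=; rewrite /dens_coord mulrDr;
    by congr (_ (_ + _)); rewrite mulrCA.
have cU := compactU cmu cnu.
apply: (subclosed_compact (@closed_closure _ _) cU).
rewrite -closureU; apply: closure_subset => p /=.
rewrite (_ : (_ + _) p = a * mu p + nu p)//.
have [->|mu0 _] := eqVneq (mu p) 0; last by left.
by rewrite mulr0 add0r; right.
Qed.

HB.instance Definition _ :=
  GRing.isSubmodClosed.Build K (X -> K^o) test_densities test_densities_submod.

Record test_density := TestDensity {
  dens_fun :> X -> K^o ;
  dens_test : dens_fun \in test_densities
}.
HB.instance Definition _ := [isSub for dens_fun].
HB.instance Definition _ := [Choice of test_density by <:].
HB.instance Definition _ := [SubChoice_isSubZmodule of test_density by <:].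
HB.instance Definition _ := [SubZmodule_isSubLmodule of test_density by <:].

Lemma dens_mul_test (f : Cinf) (mu : test_density) :
  (fun p => f p * mu p : K^o) \in test_densities.
Proof.
have /asboolP sf := Cinf_smooth f; have /asboolP[smu cmu] := dens_test mu.
apply/asboolP; split.
  move=> c ac; have oc := open_chart_img c.
  have := CkK_on_mul oc (sf c ac) (smu c ac).
  case=> h1 h2; split=> m mk; [have := h1 m mk|have := h2 m mk];
    by apply: Cm_on_eq => // y _ /=; rewrite /dens_coord mulrCA.
by apply: compact_suppS cmu => p ->; rewrite mulr0.
Qed.

Definition dens_mul (f : Cinf) (mu : test_density) : test_density :=
  TestDensity (dens_mul_test f mu).

(* Smooth partitions of unity subordinate to the cover of X by the domains of
   the charts [chart_at q]; one is chosen once and for all to integrate. *)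
Definition partition_of_unity (chi : X -> X -> R) : Prop :=
  [/\ forall q c, atlas c -> Ck_on None (chart_img c) (chi q \o chart_inv c),
      forall q p, 0 <= chi q p,
      forall q, supp (chi q) `<=` chart_dom (chart_at q),
      locally_finite setT (fun q => supp (chi q)) &
      forall p, \sum_(q \in [set: X]) chi q p = 1].

Definition chosen_partition : X -> X -> R :=
  xget (fun _ _ => 0) [set chi | partition_of_unity chi].

Definition integral_density (mu : test_density) : K :=
  \sum_(q \in [set: X])
    kintegral
      ((fun y => kpair s (chosen_partition q (chart_inv (chart_at q) y)) 0 *
                 dens_coord (chart_at q) mu (chart_inv (chart_at q) y))
       \_ (chart_img (chart_at q))).

(* Neighbourhoods of 0 in the Frechet space of densities supported in L, whose
   seminorms are the sup norms of partial derivatives of the coefficients over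
   compact subsets of chart domains; [V] is understood as its trace on it. *)
Definition nbhs0_supported (L : set X) (V : set test_density) : Prop :=
  exists2 S : set (chart R n X * set X * seq 'I_n),
    finite_set S /\ (forall c A I, S (c, A, I) ->
      [/\ atlas c, compact A & A `<=` chart_dom c]) &
    exists2 d : R, 0 < d & forall mu : test_density, supp mu `<=` L ->
      (forall c A I, S (c, A, I) -> forall p, A p ->
        kabs (kpartials I (dens_coord c mu \o chart_inv c) (c p)) < d) ->
      V mu.

Definition absolutely_convex (V : set test_density) : Prop :=
  forall (a b : K) mu nu, kabs a + kabs b <= 1 -> V mu -> V nu ->
    V (a *: mu + b *: nu).

(* Neighbourhoods of 0 in Gamma_c(X, Vol(X)) for the locally convex inductive
   limit topology of these Frechet spaces, L ranging over compact sets *)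
Definition nbhs0_test (V : set test_density) : Prop :=
  exists W : set test_density, [/\ W `<=` V, absolutely_convex W &
    forall L, compact L -> nbhs0_supported L W].

Definition is_distribution (w : test_density -> K) : Prop :=
  scalar w /\ forall d : R, 0 < d -> nbhs0_test [set mu | kabs (w mu) < d].

Definition distr_mul (f : Cinf) (w : test_density -> K) : test_density -> K :=
  fun mu => w (dens_mul f mu).

(* Linear differential operators of finite order at most m: near each point,
   in some chart, a combination with smooth coefficients of the partial
   derivatives of order at most m. Multi-indices are sequences of directions. *)
Definition diffop (P : {linear Cinf -> Cinf}) : Prop :=
  exists m : nat, forall p : X,
  exists c W (a : seq 'I_n -> 'rV[R]_n -> K),
    [/\ atlas c, open W, W p, W `<=` chart_dom c &
     (forall I, CkK_on None (c @` W) (a I)) /\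
     forall (u : Cinf) q, W q ->
       P u q = \sum_(l < m.+1) \sum_(I : l.-tuple 'I_n)
                 a I (c q) * kpartials I (u \o chart_inv c) (c q)].

Definition unit_index : Type := {e : R | 0 < e <= 1}.

Definition eps0 : set_system unit_index :=
  filter_from [set eta : R | 0 < eta]
    (fun eta => [set e : unit_index | val e < eta]).

Definition net : Type := unit_index -> Cinf.

Definition moderate (u : net) : Prop :=
  forall L : set X, compact L -> forall P, diffop P ->
  exists (N : nat) (C : R), \forall e \near eps0,
    forall p, L p -> kabs (P (u e) p) <= C * val e ^- N.

Definition negligible (u : net) : Prop :=
  forall L : set X, compact L -> forall P, diffop P -> forall m : nat,
  exists C : R, \forall e \near eps0,
    forall p, L p -> kabs (P (u e) p) <= C * val e ^+ m.

(* Generalized functions are literally cosets, modulo the negligible nets, of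
   moderate nets; [z \in cl u] means that [z] represents the class of [u]. *)
Definition cl (u : net) : set net :=
  [set v | negligible (fun e => v e - u e)].

Definition colombeau : set (set net) := [set cl u | u in moderate].

(* Componentwise product: as the negligible nets form an ideal of the moderate
   ones, this is the coset [cl (u v)] for any representatives [u], [v]. *)
Definition colombeau_mul (U V : set net) : set net :=
  [set z | exists u v, [/\ U u, V v & cl (fun e => u e * v e) z]].

Definition sigma (f : Cinf) : set net := cl (fun=> f).

(* Both association relations are stated for one representative of [U]; they do
   not depend on its choice. *)
Definition associated (U : set net) (w : test_density -> K) : Prop :=
  exists2 u, U u &
    forall mu, integral_density (dens_mul (u e) mu) @[e --> eps0] --> w mu.

Definition Ck_associated (k : option nat) (U : set net) (f : X -> K) : Prop :=
  exists2 u, U u &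
    forall xi : seq vector_field, order_le (size xi) k ->
    forall L : set X, compact L -> forall d : R, 0 < d ->
    \forall e \near eps0, forall p, L p ->
      kabs (foldr lie (fun q => u e q - f q) xi p) < d.

End Objects.

(* Main.v *)
Require Import Defs.
From HB Require Import structures.
From mathcomp Require Import all_boot all_order all_algebra.
From mathcomp Require Import all_classical all_reals all_analysis.
From mathcomp.real_closed Require Import complex.
From mathcomp Require Import ring lra.

Set Implicit Arguments.
Unset Strict Implicit.
Unset Printing Implicit Defensive.
Import Order.TTheory GRing.Theory Num.Theory.
Import numFieldNormedType.Exports.
Local Open Scope classical_set_scope.
Local Open Scope ring_scope.

(** (ii) Since X is locally compact, C^k-association says that all Lie
    derivatives of order at most k of u_eps converge continuously (along
    (p', eps) -> (p, 0)) to those of f; the Leibniz rule then expresses the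
    Lie derivatives of a product through products of convergent factors.

    (i)(b) Write h_eps = u_eps - f, so that the integral of u_eps v_eps mu is
    that of v_eps f mu, which tends to w(f mu), plus that of v_eps h_eps mu.
    The last one tends to 0 by a gliding hump: otherwise there are indices
    e_k -> 0 at which it stays away from 0, and, h_eps tending to 0 with all its
    derivatives, they can be chosen so that the sum H of the h_(e_k) converges
    together with all its derivatives near supp mu.  Then H mu is a test
    density on which the functionals defined by v_eps do not converge.  *)

(** * Differential calculus on R^n *)

(** Behind (i)(b) stands uniform boundedness: functionals that converge pointwise on the densities
    supported near [supp mu] should be equicontinuous, and so send the null net [h_eps mu] to 0. The
    gliding hump proves this by hand for that one net. It asks of the integral only additivity and a
    bound by the sup of the factor in front of a fixed density. What remains is completeness, that
    is, smoothness of [H]. The obstacle is that association controls Lie derivatives along globally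
    defined vector fields, while smoothness concerns partial derivatives in charts. Coordinate
    fields cut off by a partition of unity bridge the two: near a compact set finitely many of the
    cutoffs suffice, and words of length at most k in the resulting fields are finite in number, so
    the k-th index can make all these derivatives of [h] smaller than [2^-k] at once. The
    differential calculus is done for real functions and transferred through real and imaginary
    parts. *)

Section LineDerivative.
Context {R : realType} {V : normedModType R}.
Implicit Types (f : V -> R) (x v : V).

Lemma is_derive_line f x v (s : R) : derivable f (x + s *: v) v ->
  is_derive s 1 (fun h => f (x + h *: v)) ('D_v f (x + s *: v)).
Proof.
move=> df.
suff E : (fun h : R => h^-1 *: (((fun h => f (x + h *: v)) \o shift s) (h *: 1)
            - f (x + s *: v))) =
         (fun h => h^-1 *: ((f \o shift (x + s *: v)) (h *: v)
            - f (x + s *: v))).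
  by split; rewrite /derivable /derive E.
apply/funext => h /=; congr (_ *: (f _ - _)).
by rewrite [h *: 1]mulr1 scalerDl addrCA.
Qed.

(** The increment [h] may have either sign, so increments along coordinates and two-sided difference
    quotients need no case distinction later. *)
Lemma mvt_line f x v (h : R) :
  (forall s : R, `|s| <= `|h| -> derivable f (x + s *: v) v) ->
  exists2 s, `|s| <= `|h| & f (x + h *: v) - f x = h * 'D_v f (x + s *: v).
Proof.
move=> df; pose g (s : R) := f (x + s *: v).
have dg (s : R) : `|s| <= `|h| -> is_derive s 1 g ('D_v f (x + s *: v)).
  by move=> sh; apply: is_derive_line; exact: df.
have cg (a b : R) : (forall s : R, s \in `[a, b]%R -> `|s| <= `|h|) ->
    {within `[a, b], continuous g}.
  move=> ab; apply: (@derivable_within_continuous R R^o) => s sab.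
  exact: (@ex_derive _ _ _ _ _ _ _ (dg s (ab _ sab))).
have dab (a b : R) : (forall s : R, s \in `[a, b]%R -> `|s| <= `|h|) ->
    forall s : R, s \in `]a, b[%R -> is_derive s 1 g ('D_v f (x + s *: v)).
  by move=> ab s sab; apply: dg; apply: ab; exact: subset_itv_oo_cc.
have [h0|h0] := leP 0 h.
  have ab (s : R) : s \in `[0, h]%R -> `|s| <= `|h|.
    by rewrite in_itv /= => /andP[s0 sh]; rewrite !ger0_norm.
  have [c /ab cab E] := MVT_segment h0 (dab _ _ ab) (cg _ _ ab).
  exists c => //; move: E; rewrite /g scale0r addr0 subr0 mulrC.
  exact.
have ab (s : R) : s \in `[h, 0]%R -> `|s| <= `|h|.
  by rewrite in_itv /= => /andP[s0 sh]; rewrite !ler0_norm ?lerN2// ltW.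
have [c /ab cab E] := MVT_segment (ltW h0) (dab _ _ ab) (cg _ _ ab).
exists c => //; move/(congr1 -%R): E.
by rewrite /g scale0r addr0 sub0r opprB mulrN opprK mulrC.
Qed.

End LineDerivative.

Section EuclideanCalculus.
Context {R : realType} {n : nat}.
Implicit Types (O : set 'rV[R]_n) (f g : 'rV[R]_n -> R).
Local Notation e_ i := (delta_mx 0 i : 'rV[R]_n).

Lemma rV_norm_le (x : 'rV[R]_n) (d : R) :
  0 <= d -> (forall i, `|x 0 i| <= d) -> `|x| <= d.
Proof.
move=> d0 xd; rewrite /Num.Def.normr /= mx_normrE (bigmax_le _ d0)// => -[i j] _.
by rewrite ord1; exact: xd.
Qed.

Lemma rV_coord_le (x : 'rV[R]_n) i : `|x 0 i| <= `|x|.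
Proof.
rewrite [leRHS]/Num.Def.normr /= mx_normrE.
exact: (le_bigmax _ (fun ij : 'I_1 * 'I_n => `|x ij.1 ij.2|) (0, i)).
Qed.

(** Go from [z] to [z + w] one coordinate at a time: on each segment the mean value theorem yields a
    partial derivative at a nearby point, and its continuity replaces that point by [z]. *)
Lemma C1_diff_bound O f z (d : R) : open O -> O z -> Cm_on 1 O f -> 0 < d ->
  \forall w \near (0 : 'rV[R]_n),
    `|f (z + w) - f z - \sum_(j < n) w 0 j * 'D_(e_ j) f z| <= d * `|w|.
Proof.
(* There are [n] segments, each costing at most [d' * |w|]; dividing by [n.+1] also covers
   [n = 0]. *)
move=> oO Oz [_ Cf] d0; pose d' := d / n.+1%:R.
have d'0 : 0 < d' by rewrite divr_gt0.
have [r r0 rO] : exists2 r : R, 0 < r & forall y : 'rV[R]_n, `|y| < r ->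
    O (z + y) /\ forall j, `|'D_(e_ j) f (z + y) - 'D_(e_ j) f z| < d'.
  have : \forall y \near z,
      O y /\ forall j, `|'D_(e_ j) f y - 'D_(e_ j) f z| < d'.
    apply: filterI; first exact: open_nbhs_nbhs.
    apply: (@filter_forall _ _
      (fun j y => `|'D_(e_ j) f y - 'D_(e_ j) f z| < d') _ (nbhs_filter z)) => j.
    have [_ [cj _]] := Cf j.
    have /cvgrPdist_lt/(_ _ d'0) := cj _ Oz.
    by apply: filterS => y; rewrite distrC.
  move=> /nbhs_ballP[r /= r0 rB]; exists r => // y yr; apply: rB.
  by rewrite -ball_normE /= opprD addNKr normrN.
near=> w.
have wr : `|w| < r by near: w; exact: (@nbhs0_lt R 'rV[R]_n r r0).
(* Corners of the staircase path from 0 to [w]: the first [k] coordinates have already been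
   moved. *)
pose W (k : nat) : 'rV[R]_n := \row_i (if (i < k)%N then w 0 i else 0).
have W0 : W 0 = 0 by apply/rowP => i; rewrite !mxE.
have Wn : W n = w by apply/rowP => i; rewrite !mxE ltn_ord.
have WS (j : 'I_n) : W j.+1 = W j + w 0 j *: e_ j.
  apply/rowP => i; rewrite !mxE eqxx /= ltnS leq_eqVlt.
  have [->|ij] /= := eqVneq i j.
    by rewrite eqxx ltnn /= mulr1 add0r.
  by rewrite (_ : (nat_of_ord i == j) = false) ?mulr0 ?addr0//; apply/negbTE.
have step (j : 'I_n) : `|f (z + W j.+1) - f (z + W j) - w 0 j * 'D_(e_ j) f z|
    <= d' * `|w|.
  have small (s : R) : `|s| <= `|w 0 j| -> `|W j + s *: e_ j| < r.
    move=> sw; apply: le_lt_trans wr; apply: rV_norm_le => // i.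
    rewrite !mxE eqxx /=; have [->|ij] := eqVneq i j.
      by rewrite ltnn add0r mulr1 (le_trans sw)// rV_coord_le.
    rewrite mulr0 addr0; case: ifP => _; first exact: rV_coord_le.
    by rewrite normr0.
  have [|s sw] := @mvt_line _ _ f (z + W j) (e_ j) (w 0 j).
    move=> s sw; have [+ _] := Cf j; apply; rewrite -addrA.
    by apply: (rO _ _).1; exact: small.
  rewrite WS addrA => ->; rewrite -mulrBr normrM mulrC ler_pM//.
    by rewrite -addrA ltW//; apply: (rO _ _).2; exact: small.
  exact: rV_coord_le.
have -> : f (z + w) - f z = \sum_(j < n) (f (z + W j.+1) - f (z + W j)).
  rewrite -(big_mkord xpredT (fun j => f (z + W j.+1) - f (z + W j))).
  by rewrite telescope_sumr// Wn W0 addr0.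
rewrite -sumrB; apply: le_trans (ler_norm_sum _ _ _) _.
apply: le_trans (ler_sum _ (fun j _ => step j)) _.
rewrite sumr_const card_ord -[leLHS]mulr_natr mulrAC ler_wpM2r//.
by rewrite /d' mulrAC ler_pdivrMr// ler_pM2l// ler_nat.
Unshelve. all: by end_near. Qed.

Definition gradient_form (a : 'I_n -> R) (w : 'rV[R]_n) : R := \sum_j w 0 j * a j.

Lemma gradient_form_is_linear a : linear (gradient_form a).
Proof.
move=> k u v; rewrite /gradient_form scaler_sumr -big_split /=.
by apply: eq_bigr => j _; rewrite !mxE mulrDl -mulrA.
Qed.

HB.instance Definition _ a :=
  GRing.isLinear.Build R 'rV[R]_n R _ (gradient_form a)
    (gradient_form_is_linear a).

Lemma gradient_form_continuous a : continuous (gradient_form a).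
Proof.
move=> x; rewrite /gradient_form.
apply: (@cvg_big R 'I_n +%R 0 xpredT add_continuous _ (nbhs x) _
  (fun j w => w 0 j * a j) (fun j => x 0 j * a j) (nbhs_filter x)) => j _.
by apply: cvgM; [exact: coord_continuous|exact: cvg_cst].
Qed.

Lemma C1_differentiable O f z : open O -> O z -> Cm_on 1 O f ->
  differentiable f z /\
  forall w, 'd f z w = \sum_(j < n) w 0 j * 'D_(e_ j) f z.
Proof.
move=> oO Oz Cf; pose a j := 'D_(e_ j) f z.
have E : f \o shift z = cst (f z) + gradient_form a +o_ (0 : 'rV[R]_n) id.
  apply/eqaddoP => d d0; near=> w.
  rewrite /= !fctE /= opprD addrA [w + z]addrC.
  by near: w; exact: C1_diff_bound Cf d0.
have D := diff_unique (@gradient_form_continuous a) E.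
split; last by move=> w; rewrite D.
by apply/diff_locallyP; rewrite D; split => //; exact: gradient_form_continuous.
Unshelve. all: by end_near. Qed.

(** [phi] is only derivable in the direction [v], but its restriction to the line through [y] is a
    function of one variable, hence differentiable, and the chain rule for differentials applies to
    that curve. *)
Lemma C1_is_derive_comp {V : normedModType R} O f (phi : V -> 'rV[R]_n) y v :
  open O -> O (phi y) -> Cm_on 1 O f -> derivable phi y v ->
  is_derive y v (f \o phi)
    (\sum_(j < n) ('D_v phi y) 0 j * 'D_(e_ j) f (phi y)).
Proof.
move=> oO Oz Cf dphi.
have [df dfE] := C1_differentiable oO Oz Cf.
have /derivable1_diffP dl := (derivable1P phi y v).1 dphi.
pose l (h : R) := phi (h *: v + y).
have l0 : l 0 = phi y by rewrite /l scale0r add0r.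
have dfl : differentiable f (l 0) by rewrite l0.
have dc : differentiable (f \o l) 0 by exact: differentiable_comp.
have dfp : derivable (f \o phi) y v.
  by apply/derivable1P/derivable1_diffP.
split=> //.
have line1 (W : normedModType R) (g : V -> W) :
    'D_v g y = 'D_1 (fun h : R => g (h *: v + y)) 0.
  rewrite /derive; congr (lim (_ @ 0^')); apply/funext => h /=.
  by rewrite scale0r add0r addr0 [h *: 1]mulr1.
have -> : 'D_v (f \o phi) y = 'D_1 (f \o l) 0 by rewrite line1.
rewrite (deriveE _ dc).
rewrite (diff_comp dl dfl).
transitivity ('d f (l 0) ('d l 0 1)); first by [].
by rewrite l0 dfE -(deriveE _ dl) -line1.
Qed.

End EuclideanCalculus.

(** * Stability of C^m under localisation, inversion and composition *)

Section CmClosure.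
Context {R : realType} {n : nat}.
Implicit Types (O : set 'rV[R]_n) (f g : 'rV[R]_n -> R).
Local Notation e_ i := (delta_mx 0 i : 'rV[R]_n).

Lemma Cm_on_continuous m O f y : Cm_on m O f -> O y -> {for y, continuous f}.
Proof. by case: m => [|m] [cf _]; exact: cf. Qed.

Lemma Cm_on_leq m m' O f : (m <= m')%N -> Cm_on m' O f -> Cm_on m O f.
Proof.
move=> /subnK <-; elim: (m' - m)%N => [//|k IH].
by rewrite addSn => /Cm_on_pred.
Qed.

Lemma Cm_on_sub m O O' f : O' `<=` O -> Cm_on m O f -> Cm_on m O' f.
Proof.
move=> O'O; elim: m f => [|m IH] f [cf df]; split; try by move=> y /O'O; exact: cf.
  by [].
move=> i; have [dfi Cf] := df i; split; first by move=> y /O'O; exact: dfi.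
exact: IH.
Qed.

(** Continuity and derivatives in [Cm_on] are those of the ambient space, not relative to the set,
    so every clause can be checked point by point. *)
Lemma Cm_on_local m O f :
  (forall y, O y -> exists2 O', O' y & Cm_on m O' f) -> Cm_on m O f.
Proof.
elim: m f => [|m IH] f loc; split=> //;
  try by move=> y /loc[B By] /Cm_on_continuous; exact.
move=> i; split; first by move=> y /loc[B By] [_ /(_ i)[+ _]]; exact.
by apply: IH => y /loc[B By] [_ /(_ i)[_ Cf]]; exists B.
Qed.

Lemma Cm_on_sum m O (I : Type) (r : seq I) (F : I -> 'rV[R]_n -> R) : open O ->
  (forall i, Cm_on m O (F i)) -> Cm_on m O (fun y => \sum_(i <- r) F i y).
Proof.
move=> oO CF; elim: r => [|i r IH].
  by apply: Cm_on_eq (Cm_on_cst m 0 oO) => // y _; rewrite big_nil.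
by apply: Cm_on_eq (Cm_on_add oO (CF i) IH) => // y _; rewrite big_cons.
Qed.

Lemma Cm_on_inv m O f : open O -> (forall y, O y -> f y != 0) ->
  Cm_on m O f -> Cm_on m O (fun y => (f y)^-1).
Proof.
move=> oO f0; elim: m => [|m IH] Cf; split=> //;
  try by move=> y Oy; apply: (@continuousV _ _ f y (f0 _ Oy)); exact: Cm_on_continuous Cf Oy.
have [_ df] := Cf; move=> i; have [dfi Cfi] := df i; split.
  by move=> y Oy; apply: derivableV; [exact: f0|exact: dfi].
have CV := IH (Cm_on_pred Cf).
have := Cm_on_mul oO (Cm_on_mul oO (Cm_on_cst m (-1) oO) (Cm_on_mul oO CV CV)) Cfi.
apply: Cm_on_eq => // y Oy.
rewrite (deriveV (f0 _ Oy) (dfi _ Oy)) mulN1r expr2 invfM.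
by rewrite -mulNr.
Qed.

Lemma derivable_rowP {V : normedModType R} (phi : V -> 'rV[R]_n) y v :
  (forall i, derivable (fun z => phi z 0 i) y v) ->
  derivable phi y v /\ forall i, ('D_v phi y) 0 i = 'D_v (fun z => phi z 0 i) y.
Proof.
move=> dphi; have d : derivable phi y v.
  by apply/derivable_mxP => i j; rewrite ord1.
by split=> // i; rewrite derive_mx// mxE.
Qed.

Lemma Cm_on_is_derive_comp m O O' (phi : 'rV[R]_n -> 'rV[R]_n) f y v :
  open O -> open O' -> O' y -> O (phi y) ->
  (forall i, Cm_on m.+1 O' (fun z => phi z 0 i)) -> Cm_on m.+1 O f ->
  is_derive y v (f \o phi)
    (\sum_(j < n) 'D_v (fun z => phi z 0 j) y * 'D_(e_ j) f (phi y)).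
Proof.
move=> oO oO' O'y Oy Cphi Cf.
have dphi i : derivable (fun z => phi z 0 i) y v.
  by apply: diff_derivable; exact: (C1_differentiable oO' O'y (Cm_on_leq _ (Cphi i))).1.
have [d E] := derivable_rowP dphi.
have := C1_is_derive_comp oO Oy (Cm_on_leq _ Cf) d.
by under eq_bigr do rewrite E; exact.
Qed.

Lemma continuous_row {T : topologicalType} (phi : T -> 'rV[R]_n) y :
  (forall i, {for y, continuous (fun z => phi z 0 i)}) -> {for y, continuous phi}.
Proof.
move=> c A [P yP PA].
suff : \forall z \near y, forall i, P 0 i (phi z 0 i).
  by apply: filterS => z zP; apply: PA => i j; rewrite ord1.
apply: (@filter_forall _ _ (fun i z => P 0 i (phi z 0 i)) _ (nbhs_filter y)) => i.
exact: (c i _ (yP 0 i)).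
Qed.

(** By the chain rule a partial derivative of [f \o phi] is a sum of products of a derivative of
    [phi] with some ['D_(e_ j) f \o phi], and the latter is again a composition, one order lower. *)
Lemma Cm_on_comp m O O' (phi : 'rV[R]_n -> 'rV[R]_n) f :
  open O -> open O' -> (forall y, O' y -> O (phi y)) ->
  (forall i, Cm_on m O' (fun z => phi z 0 i)) -> Cm_on m O f ->
  Cm_on m O' (f \o phi).
Proof.
move=> oO oO' OO'; elim: m f => [|m IH] f Cphi Cf.
  split=> // y O'y; apply: continuous_comp.
    by apply: continuous_row => i; exact: Cm_on_continuous (Cphi i) O'y.
  exact: Cm_on_continuous Cf (OO' _ O'y).
have D y i : O' y -> is_derive y (e_ i) (f \o phi)
    (\sum_(j < n) 'D_(e_ i) (fun z => phi z 0 j) y * 'D_(e_ j) f (phi y)).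
  by move=> O'y; apply: Cm_on_is_derive_comp (OO' _ O'y) Cphi Cf.
split.
  move=> y O'y; apply: continuous_comp.
    by apply: continuous_row => i; exact: Cm_on_continuous (Cphi i) O'y.
  exact: Cm_on_continuous Cf (OO' _ O'y).
move=> i; split.
  by move=> y O'y; exact: (@ex_derive _ _ _ _ _ _ _ (D y i O'y)).
pose F j y := 'D_(e_ i) (fun z => phi z 0 j) y * 'D_(e_ j) f (phi y).
have : Cm_on m O' (fun y => \sum_(j < n) F j y).
  apply: Cm_on_sum => // j; apply: Cm_on_mul => //.
    by have [_ /(_ i)[]] := Cphi j.
  apply: (IH ('D_(e_ j) f)) => [k|]; first exact/Cm_on_pred/Cphi.
  by have [_ /(_ j)[]] := Cf.
apply: Cm_on_eq => // y O'y.
by rewrite (@derive_val _ _ _ _ _ _ _ (D y i O'y)).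
Qed.

End CmClosure.

(** * Real and imaginary parts *)

Section ScalarParts.
Context {R : realType} {s : scalar_kind}.
Local Notation K := (scalars R s).

Lemma kre_pair (a b : R) : kre (kpair s a b) = a.
Proof. by case: s. Qed.

Lemma kpairD (a b a' b' : R) :
  kpair s a b + kpair s a' b' = kpair s (a + a') (b + b') :> K.
Proof. by case: s. Qed.

Lemma kpair_re_im (z : K) : kpair s (kre z) (kim z) = z.
Proof. by case: s z => [|] // []. Qed.

Lemma kreB (a b : K) : kre (a - b) = kre a - kre b.
Proof. by move: a b; case: s => // -[? ?] [? ?]. Qed.

Lemma kimB (a b : K) : kim (a - b) = kim a - kim b.
Proof. by move: a b; case: s => [? ?|[? ?] [? ?]] //=; rewrite subr0. Qed.

Lemma kabsE (z : K) : `|z| = kpair s (kabs z) 0.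
Proof. by case: s z => // z; rewrite /kabs /= normc_def. Qed.

Lemma kpair0_le (a b : R) : (kpair s a 0 <= kpair s b 0) = (a <= b).
Proof. by case: s => //=; rewrite lecE /= eqxx. Qed.

Lemma kpair0_lt (a b : R) : (kpair s a 0 < kpair s b 0) = (a < b).
Proof. by case: s => //=; rewrite ltcE /= eqxx. Qed.

Lemma kpair0_inj (a b : R) : kpair s a 0 = kpair s b 0 -> a = b.
Proof. by move=> /(congr1 (@kre R s)); rewrite !kre_pair. Qed.

Lemma kpair0M (a b : R) : kpair s a 0 * kpair s b 0 = kpair s (a * b) 0.
Proof.
by case: s => //=; apply/eqP; rewrite eq_complex /= !mulr0 mul0r subr0 addr0 !eqxx.
Qed.

Lemma kpair00 : kpair s 0 0 = 0 :> K.
Proof. by case: s. Qed.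

Lemma kre0 : kre (0 : K) = 0.
Proof. by case: s. Qed.

Lemma kim0 : kim (0 : K) = 0.
Proof. by case: s. Qed.

Lemma kabs_eq0 (z : K) : kabs z <= 0 -> z = 0.
Proof.
move=> z0; apply/eqP; rewrite -normr_le0 kabsE -kpair00.
by case: s z z0 => //= z z0; rewrite lecE /= eqxx.
Qed.

Lemma kpos_real (d : K) : 0 < d -> d = kpair s (kre d) 0.
Proof. by case: s d => //= -[a b]; rewrite ltcE /= => /andP[/eqP <-]. Qed.

Lemma kabsM (x y : K) : kabs (x * y) = kabs x * kabs y.
Proof. by apply: kpair0_inj; rewrite -kpair0M -!kabsE normrM. Qed.

Lemma kabs_ge0 (x : K) : 0 <= kabs x.
Proof. by rewrite -kpair0_le -kabsE kpair00 normr_ge0. Qed.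

Lemma kabsD (x y : K) : kabs (x + y) <= kabs x + kabs y.
Proof.
by rewrite -kpair0_le -kabsE -[0 in leRHS]addr0 -kpairD -!kabsE ler_normD.
Qed.

Lemma kabsN (x : K) : kabs (- x) = kabs x.
Proof. by apply: kpair0_inj; rewrite -!kabsE normrN. Qed.

Lemma kabs0 : kabs (0 : K) = 0.
Proof. by apply: kpair0_inj; rewrite -kabsE normr0 kpair00. Qed.

Lemma kre_le (z : K) : `|kre z| <= kabs z.
Proof.
case: s z => [z|[a b]] /=; first by rewrite /kabs.
rewrite /kabs /=.
by rewrite -sqrtr_sqr ler_sqrt ?addr_ge0 ?sqr_ge0// lerDl sqr_ge0.
Qed.

Lemma kim_le (z : K) : `|kim z| <= kabs z.
Proof.
case: s z => [z|[a b]] /=; first by rewrite normr0 normr_ge0.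
rewrite /kabs /=.
by rewrite -sqrtr_sqr ler_sqrt ?addr_ge0 ?sqr_ge0// lerDr sqr_ge0.
Qed.

Lemma kabs_le (z : K) : kabs z <= `|kre z| + `|kim z|.
Proof.
case: s z => [z|[a b]]; first by rewrite /kabs /= normr0 addr0.
rewrite /kabs /= -(ler_sqr (sqrtr_ge0 _)) ?nnegrE ?addr_ge0//.
rewrite sqr_sqrtr ?addr_ge0 ?sqr_ge0// sqrrD !real_normK ?num_real//.
by rewrite addrAC lerDl mulrn_wge0// mulr_ge0.
Qed.

(** Radii of balls in [K] are positive elements of [K]; over the complex numbers such an element is
    real, so real radii suffice. *)
Lemma kcvgP {T : Type} (F : set_system T) {FF : Filter F} (f : T -> K) (l : K) :
  f @ F --> l <-> forall d : R, 0 < d -> \forall t \near F, kabs (f t - l) < d.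
Proof.
split=> [/cvgrPdist_lt fl d d0|fl].
  have /fl : 0 < kpair s d 0 by rewrite -[ltLHS]kpair00 kpair0_lt.
  by apply: filterS => t; rewrite kabsE kpair0_lt -kabsN opprB.
apply/cvgrPdist_lt => d d0; have dE := kpos_real d0.
have /fl : 0 < kre d by rewrite -kpair0_lt kpair00 -dE.
by apply: filterS => t td; rewrite kabsE dE kpair0_lt -kabsN opprB.
Qed.

End ScalarParts.

(** * Lie derivatives of real functions *)

Section RealLie.
Context {R : realType} {n : nat} {X : manifold R n}.
Local Notation e_ i := (delta_mx 0 i : 'rV[R]_n).
Implicit Types (c : chart R n X) (f g : X -> R) (W : set X).

Definition chart_trace c W : set 'rV[R]_n := c @` (chart_dom c `&` W).

Lemma chart_imgP c p : chart_dom c p -> chart_img c (c p).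
Proof. by exists p. Qed.

Lemma chart_traceP c W y :
  chart_trace c W y <-> chart_img c y /\ W (chart_inv c y).
Proof.
split=> [[p [cp Wp] <-]|[[p cp <-]]].
  by rewrite chart_mapK//; split=> //; exact: chart_imgP.
by rewrite chart_mapK// => Wp; exists p.
Qed.

Lemma chart_invK c y : chart_img c y -> c (chart_inv c y) = y.
Proof. by move=> [p cp <-]; rewrite chart_mapK. Qed.

Lemma chart_inv_dom c y : chart_img c y -> chart_dom c (chart_inv c y).
Proof. by move=> [p cp <-]; rewrite chart_mapK. Qed.

Lemma chart_inv_near c W y : open W -> chart_img c y -> W (chart_inv c y) ->
  \forall z \near y, W (chart_inv c z).
Proof.
move=> oW cy Wy; apply: (@chart_inv_continuous _ _ _ c y cy).
exact: open_nbhs_nbhs.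
Qed.

Lemma open_chart_trace c W : open W -> open (chart_trace c W).
Proof.
move=> oW; rewrite openE => y /chart_traceP[cy Wy].
have oc : nbhs y (chart_img c) by apply: open_nbhs_nbhs; split=> //; exact: open_chart_img.
apply: filterS (filterI oc (chart_inv_near oW cy Wy)) => z [cz Wz].
exact/chart_traceP.
Qed.

Arguments open_chart_trace c {W}.

Definition CmR_on (m : nat) (W : set X) f : Prop :=
  forall c, atlas c -> Cm_on m (chart_trace c W) (f \o chart_inv c).

Lemma chart_traceT c : chart_trace c setT = chart_img c.
Proof. by rewrite /chart_trace setIT. Qed.

Lemma CmR_on_leq m m' W f : (m <= m')%N -> CmR_on m' W f -> CmR_on m W f.
Proof. by move=> mm' Cf c ac; apply: Cm_on_leq (Cf c ac). Qed.

Lemma CmR_onD m W f g : open W -> CmR_on m W f -> CmR_on m W g ->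
  CmR_on m W (fun p => f p + g p).
Proof.
by move=> oW Cf Cg c ac; exact: (Cm_on_add (open_chart_trace c oW) (Cf c ac) (Cg c ac)).
Qed.

Lemma CmR_onM m W f g : open W -> CmR_on m W f -> CmR_on m W g ->
  CmR_on m W (fun p => f p * g p).
Proof.
by move=> oW Cf Cg c ac; exact: (Cm_on_mul (open_chart_trace c oW) (Cf c ac) (Cg c ac)).
Qed.

Lemma CmR_on_cst m W (a : R) : open W -> CmR_on m W (fun=> a).
Proof. by move=> oW c ac; exact: (Cm_on_cst m a (open_chart_trace c oW)). Qed.

Lemma CmR_on_eq m W f g : open W -> (forall p, W p -> f p = g p) ->
  CmR_on m W f -> CmR_on m W g.
Proof.
move=> oW fg Cf c ac; apply: Cm_on_eq (Cf c ac); first exact: open_chart_trace.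
by move=> y /chart_traceP[_ /fg].
Qed.

Lemma CmR_on_continuous m W f p : open W -> W p -> CmR_on m W f ->
  {for p, continuous f}.
Proof.
move=> oW Wp Cf; pose c := chart_at p.
have cp : chart_dom c p by exact: chart_at_dom.
have tp : chart_trace c W (c p) by exists p.
have cf := Cm_on_continuous (Cf c (atlas_chart_at p)) tp.
have := @continuous_comp _ _ _ c (f \o chart_inv c) p
   (@chart_map_continuous _ _ _ c p cp) cf.
rewrite /prop_for /continuous_at /= chart_mapK//; apply: cvg_trans.
apply: (@near_eq_cvg _ _ (nbhs p) (nbhs_filter p)).
have : nbhs p (chart_dom c).
  by apply: open_nbhs_nbhs; split=> //; exact: chart_dom_open.
by apply: filterS => q cq /=; rewrite chart_mapK.
Qed.

(** Near [d p], the function [f \o chart_inv d] is [f \o chart_inv c] composed with the transition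
    map, to which the chain rule applies. *)
Lemma transition_is_derive_comp m W (c d : chart R n X) f p v :
  atlas c -> atlas d -> chart_dom c p -> chart_dom d p -> open W -> W p ->
  CmR_on m.+1 W f ->
  is_derive (d p) v (f \o chart_inv d)
    (\sum_(j < n) ('D_v (c \o chart_inv d) (d p)) 0 j
                  * 'D_(e_ j) (f \o chart_inv c) (c p)).
Proof.
move=> ac ad cp dp oW Wp Cf.
have oD := open_chart_trace d (@chart_dom_open _ _ _ c).
have oC := open_chart_trace c oW.
have tp : chart_trace d (chart_dom c) (d p) by exists p.
have dphi i : derivable (fun z => (c \o chart_inv d) z 0 i) (d p) v.
  apply: diff_derivable.
  by apply: (C1_differentiable oD tp _).1; exact: (transition_smooth ad ac i).
have [dp1 _] := derivable_rowP dphi.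
have Op : chart_trace c W ((c \o chart_inv d) (d p)) by exists p; rewrite /= ?chart_mapK.
have := C1_is_derive_comp oC Op (Cm_on_leq (ltn0Sn m : (1 <= m.+1)%N) (Cf c ac)) dp1.
rewrite [in X in is_derive _ _ _ X]/= chart_mapK//.
apply: near_eq_is_derive.
have : nbhs (d p) (chart_trace d (chart_dom c)) by exact: open_nbhs_nbhs.
apply: filterS => y /chart_traceP[dy cy] /=; by rewrite chart_mapK.
Qed.

(** It takes a bare section, not a [vector_field], so that derivatives along the frame fields make
    sense before these are known to be smooth. *)
Definition lieR (xi : X -> 'rV[R]_n) f : X -> R :=
  fun p => 'D_(xi p) (f \o chart_inv (chart_at p)) (chart_at p p).

(** [lieR] is computed at [p] in [chart_at p], which may jump as [p] moves. In a fixed chart it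
    becomes a first-order operator with the components of [xi] as coefficients, the form that can be
    differentiated again. *)
Lemma lieR_chart m W (c : chart R n X) (xi : X -> 'rV[R]_n) f p :
  atlas c -> chart_dom c p -> open W -> W p -> CmR_on m.+1 W f ->
  lieR xi f p =
  \sum_(j < n) vf_coord c xi p 0 j * 'D_(e_ j) (f \o chart_inv c) (c p).
Proof.
move=> ac cp oW Wp Cf; have D := transition_is_derive_comp (xi p) ac
  (atlas_chart_at p) cp (chart_at_dom p) oW Wp Cf.
by rewrite /lieR (@derive_val _ _ _ _ _ _ _ D).
Qed.

Lemma CmR_on_lieR m W (xi : vector_field X) f : open W ->
  CmR_on m.+1 W f -> CmR_on m W (lieR xi f).
Proof.
move=> oW Cf c ac; have oC := open_chart_trace c oW.
pose F j y := vf_coord c xi (chart_inv c y) 0 j * 'D_(e_ j) (f \o chart_inv c) y.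
have : Cm_on m (chart_trace c W) (fun y => \sum_(j < n) F j y).
  apply: Cm_on_sum => // j; apply: Cm_on_mul => //.
    have := vf_smooth xi ac j (I : order_le m None).
    by apply: Cm_on_sub => y /chart_traceP[].
  by have [_ /(_ j)[]] := Cf c ac.
apply: Cm_on_eq => // y /chart_traceP[cy Wy] /=.
rewrite (lieR_chart _ ac (chart_inv_dom cy) oW Wy Cf).
by apply: eq_bigr => j _; rewrite /F chart_invK.
Qed.

Lemma lieR_derivable W f p v : open W -> W p -> CmR_on 1 W f ->
  derivable (f \o chart_inv (chart_at p)) (chart_at p p) v.
Proof.
move=> oW Wp Cf; apply: diff_derivable.
apply: (C1_differentiable (open_chart_trace _ oW) _ (Cf _ (atlas_chart_at p))).1.
by exists p => //; split=> //; exact: chart_at_dom.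
Qed.

Lemma lieRD W xi f g p : open W -> W p -> CmR_on 1 W f -> CmR_on 1 W g ->
  lieR xi (fun q => f q + g q) p = lieR xi f p + lieR xi g p.
Proof.
move=> oW Wp Cf Cg; have df := @lieR_derivable W f p (xi p) oW Wp Cf.
by have dg := @lieR_derivable W g p (xi p) oW Wp Cg; rewrite [LHS](deriveD df dg).
Qed.

Lemma lieRM W xi f g p : open W -> W p -> CmR_on 1 W f -> CmR_on 1 W g ->
  lieR xi (fun q => f q * g q) p = lieR xi f p * g p + f p * lieR xi g p.
Proof.
move=> oW Wp Cf Cg; have df := @lieR_derivable W f p (xi p) oW Wp Cf.
have dg := @lieR_derivable W g p (xi p) oW Wp Cg.
rewrite [LHS](deriveM df dg) /= chart_mapK; last exact: chart_at_dom.
by rewrite addrC /lieR; congr (_ + _); exact: mulrC.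
Qed.

End RealLie.
Arguments open_chart_trace {R n X} c {W}.

(** * Convergence of Lie derivatives *)

Section LieConvergence.
Context {R : realType} {n : nat} {X : manifold R n}.
Implicit Types (f g : X -> R) (xs : seq (vector_field X)).

Definition CmR (m : nat) f := CmR_on m setT f.

Definition lie_iter xs f : X -> R :=
  foldr (fun xi : vector_field X => lieR xi) f xs.

Lemma lie_iter_rcons xs xi f : lie_iter (rcons xs xi) f = lie_iter xs (lieR xi f).
Proof. by rewrite /lie_iter foldr_rcons. Qed.

Lemma CmR_lieR m (xi : vector_field X) f : CmR m.+1 f -> CmR m (lieR xi f).
Proof. exact: CmR_on_lieR openT. Qed.

Lemma CmR_lie_iter m xs f : CmR (size xs + m) f -> CmR m (lie_iter xs f).
Proof.
by elim: xs m => [//|xi xs IH] m Cf; apply/CmR_lieR/IH; rewrite addnS.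
Qed.

Lemma CmRD m f g : CmR m f -> CmR m g -> CmR m (fun p => f p + g p).
Proof. exact: CmR_onD openT. Qed.

Lemma CmRM m f g : CmR m f -> CmR m g -> CmR m (fun p => f p * g p).
Proof. exact: CmR_onM openT. Qed.

Lemma CmRB m f g : CmR m f -> CmR m g -> CmR m (fun p => f p - g p).
Proof.
move=> Cf Cg; have := CmRD Cf (CmRM (CmR_on_cst m (-1) openT) Cg).
by apply: CmR_on_eq openT _ => p _; rewrite mulN1r.
Qed.

Lemma CmR_continuous m f : CmR m f -> continuous f.
Proof. by move=> Cf p; exact: (CmR_on_continuous openT _ Cf). Qed.

(** Fields are peeled off from the inside: the innermost one acts on [f] and [g] themselves, whose
    regularity is known, and linearity of a single Lie derivative needs that regularity. *)
Lemma lie_iterD xs f g : CmR (size xs) f -> CmR (size xs) g ->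
  lie_iter xs (fun p => f p + g p) = (fun p => lie_iter xs f p + lie_iter xs g p).
Proof.
elim/last_ind: xs f g => [//|xs xi IH] f g; rewrite size_rcons => Cf Cg.
rewrite !lie_iter_rcons.
have -> : lieR xi (fun p => f p + g p) = (fun p => lieR xi f p + lieR xi g p).
  have C1 (h : X -> R) : CmR (size xs).+1 h -> CmR 1 h by exact: CmR_on_leq.
  by apply/funext => p; exact: (lieRD xi openT I (C1 _ Cf) (C1 _ Cg)).
by rewrite IH//; exact: CmR_lieR.
Qed.

Lemma lie_iterB xs f g : CmR (size xs) f -> CmR (size xs) g ->
  lie_iter xs (fun p => f p - g p) = (fun p => lie_iter xs f p - lie_iter xs g p).
Proof.
move=> Cf Cg; have := lie_iterD (CmRB Cf Cg) Cg.
under [in LHS]eq_fun do rewrite subrK.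
by move=> ->; apply/funext => p; rewrite addrK.
Qed.

Lemma lieR_mul xi f g : CmR 1 f -> CmR 1 g ->
  lieR xi (fun p => f p * g p) = (fun p => lieR xi f p * g p + f p * lieR xi g p).
Proof. by move=> Cf Cg; apply/funext => p; exact: (lieRM xi openT I Cf Cg). Qed.

Lemma lie_iter_continuous xs f : CmR (size xs) f -> continuous (lie_iter xs f).
Proof.
by move=> Cf; apply: (@CmR_continuous 0); apply: CmR_lie_iter; rewrite addn0.
Qed.

(* Continuous convergence: on X it is locally uniform convergence whenever the
   limit is continuous. *)
Definition cconv {I : Type} (F : set_system I) (a : I -> X -> R) f : Prop :=
  forall p, (fun z : X * I => a z.2 z.1) @ filter_prod (nbhs p) F --> f p.

Definition lie_conv {I : Type} m (F : set_system I) (a : I -> X -> R) f : Prop :=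
  forall xs, (size xs <= m)%N ->
    cconv F (fun i => lie_iter xs (a i)) (lie_iter xs f).

Lemma cconv_eq {I : Type} (F : set_system I) (a b : I -> X -> R) f g :
  (forall i p, a i p = b i p) -> f =1 g -> cconv F a f -> cconv F b g.
Proof.
move=> ab; rewrite (_ : a = b); [move|by apply/funext => i; exact/funext].
by move=> /funext ->.
Qed.

Lemma lie_conv_eq {I : Type} m (F : set_system I) (a b : I -> X -> R) f g :
  (forall i p, a i p = b i p) -> f =1 g -> lie_conv m F a f -> lie_conv m F b g.
Proof.
move=> ab; rewrite (_ : a = b); [move|by apply/funext => i; exact/funext].
by move=> /funext ->.
Qed.

Section Filter.
Context {I : Type} {F : set_system I} {FF : Filter F}.
Implicit Types (a b : I -> X -> R).

Lemma cconvD a b f g : cconv F a f -> cconv F b g ->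
  cconv F (fun i p => a i p + b i p) (fun p => f p + g p).
Proof. by move=> af bg p; exact: cvgD (af p) (bg p). Qed.

Lemma cconvB a b f g : cconv F a f -> cconv F b g ->
  cconv F (fun i p => a i p - b i p) (fun p => f p - g p).
Proof. by move=> af bg p; exact: cvgB (af p) (bg p). Qed.

Lemma cconvM a b f g : cconv F a f -> cconv F b g ->
  cconv F (fun i p => a i p * b i p) (fun p => f p * g p).
Proof. by move=> af bg p; exact: cvgM (af p) (bg p). Qed.

Lemma cconv_cst f : continuous f -> cconv F (fun=> f) f.
Proof. by move=> cf p; apply: (@cvg_comp _ _ _ fst f _ _ _ _ (cf p)); exact: cvg_fst. Qed.

(** Continuous convergence gives the bound on a product neighbourhood of each point of [L], which is
    exactly what compactness in its near-covering form consumes. *)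
Lemma cconv_uniform a (L : set X) d : cconv F a (fun=> 0) -> compact L -> 0 < d ->
  \forall i \near F, forall p, L p -> `|a i p| < d.
Proof.
move=> a0 /compact_near_coveringP cL d0.
apply: (cL I F (fun i p => `|a i p| < d)) => p Lp.
by have /cvgr0Pnorm_lt/(_ _ d0) := a0 p.
Qed.

Lemma lie_convD m a b f g : (forall i, CmR m (a i)) -> (forall i, CmR m (b i)) ->
  CmR m f -> CmR m g -> lie_conv m F a f -> lie_conv m F b g ->
  lie_conv m F (fun i p => a i p + b i p) (fun p => f p + g p).
Proof.
move=> Ca Cb Cf Cg af bg xs xm; have := cconvD (af xs xm) (bg xs xm).
have Cx (h : X -> R) : CmR m h -> CmR (size xs) h by exact: CmR_on_leq.
rewrite (lie_iterD (Cx _ Cf) (Cx _ Cg)).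
by under [X in _ -> cconv _ X _]eq_fun do rewrite (lie_iterD (Cx _ (Ca _)) (Cx _ (Cb _))).
Qed.

(** The Leibniz rule without binomial sums: the innermost field turns the product into a sum of two
    products, and each of them falls under the induction hypothesis one order lower. *)
Lemma lie_convM m a b f g : (forall i, CmR m (a i)) -> (forall i, CmR m (b i)) ->
  CmR m f -> CmR m g -> lie_conv m F a f -> lie_conv m F b g ->
  lie_conv m F (fun i p => a i p * b i p) (fun p => f p * g p).
Proof.
elim: m a b f g => [|m IH] a b f g Ca Cb Cf Cg af bg xs.
  by case: xs => // _; exact: cconvM (af [::] _) (bg [::] _).
case/lastP: xs => [_|xs xi]; first exact: cconvM (af [::] _) (bg [::] _).
rewrite size_rcons ltnS => xm.
have C1 (h : X -> R) : CmR m.+1 h -> CmR 1 h by exact: CmR_on_leq.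
have Cm (h : X -> R) : CmR m.+1 h -> CmR m h by exact: CmR_on_leq.
rewrite lie_iter_rcons (lieR_mul _ (C1 _ Cf) (C1 _ Cg)).
under eq_fun do rewrite lie_iter_rcons (lieR_mul _ (C1 _ (Ca _)) (C1 _ (Cb _))).
have lieC (c : I -> X -> R) h : lie_conv m.+1 F c h ->
    lie_conv m F (fun i => lieR xi (c i)) (lieR xi h).
  move=> ch ys ym; rewrite -lie_iter_rcons; under eq_fun do rewrite -lie_iter_rcons.
  by apply: ch; rewrite size_rcons.
have lieS (c : I -> X -> R) h : lie_conv m.+1 F c h -> lie_conv m F c h.
  by move=> ch ys ym; apply: ch; exact: leqW.
apply: (@lie_convD m (fun i p => lieR xi (a i) p * b i p)
  (fun i p => a i p * lieR xi (b i) p) (fun p => lieR xi f p * g p)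
  (fun p => f p * lieR xi g p)) xm => [i|i||||].
- by apply: CmRM; [exact/CmR_lieR|exact/Cm].
- by apply: CmRM; [exact/Cm|exact/CmR_lieR].
- by apply: CmRM; [exact/CmR_lieR|exact/Cm].
- by apply: CmRM; [exact/Cm|exact/CmR_lieR].
- apply: IH => [i|i||||];
    [exact/CmR_lieR|exact/Cm|exact/CmR_lieR|exact/Cm|exact/lieC|exact/lieS].
- apply: IH => [i|i||||];
    [exact/Cm|exact/CmR_lieR|exact/Cm|exact/CmR_lieR|exact/lieS|exact/lieC].
Qed.

End Filter.

Lemma locally_compact_manifold (p : X) : exists2 K : set X, compact K & nbhs p K.
Proof.
pose c := chart_at p; have cp : chart_dom c p := chart_at_dom p.
have : nbhs (c p) (chart_img c).
  by apply: open_nbhs_nbhs; split; [exact: open_chart_img|exact: chart_imgP].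
move=> /nbhs_closedballP[r rc]; pose B := closed_ball (c p) r%:num.
exists (chart_inv c @` B).
  apply: continuous_compact.
    apply: continuous_in_subspaceT => y /set_mem By.
    exact: (@chart_inv_continuous _ _ _ c y (rc _ By)).
  apply: bounded_closed_compact; last exact: closed_ball_closed.
  exists (`|c p| + r%:num); split; first exact: num_real.
  move=> M Mlt y; rewrite /B closed_ballE// /closed_ball_ /= => yr.
  apply: ltW; apply: le_lt_trans Mlt.
  by rewrite -lerBlDl (le_trans _ yr)// distrC lerB_dist.
have cB : nbhs (c p) B.
  by apply: (filterS (@subset_closed_ball _ _ (c p) r%:num)); exact: nbhsx_ballx.
have dp : nbhs p (chart_dom c).
  by apply: open_nbhs_nbhs; split=> //; exact: chart_dom_open.
have cont := @chart_map_continuous _ _ _ c p cp _ cB.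
apply: filterS (filterI dp cont) => q [cq Bq].
by exists (c q) => //; rewrite chart_mapK.
Qed.

(** Local compactness enters here: uniform smallness on a compact neighbourhood of [p] is smallness
    on a product neighbourhood. *)
Lemma uniform_cconv {I : Type} {F : set_system I} {FF : Filter F} (a : I -> X -> R) :
  (forall L, compact L -> forall d, 0 < d ->
     \forall i \near F, forall p, L p -> `|a i p| < d) ->
  cconv F a (fun=> 0).
Proof.
move=> au p; apply/cvgr0Pnorm_lt => d d0.
have [K cK pK] := locally_compact_manifold p.
exists (K, [set i | forall p, K p -> `|a i p| < d]); first by split=> //; exact: au.
by move=> [q i] [/= Kq]; exact.
Qed.

End LieConvergence.

(** * C^k-association through real and imaginary parts, and the proof of (ii) *)

Section ScalarLie.
Context {R : realType} {s : scalar_kind} {n : nat} {X : manifold R n}.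
Local Notation K := (scalars R s).

Global Instance eps0_filter : ProperFilter (@eps0 R).
Proof.
apply: filter_from_proper; last first.
  move=> eta /= eta0; pose e := Num.min 1 (eta / 2).
  have e0 : 0 < e <= 1 by rewrite lt_min ltr01 divr_gt0//= ge_min lexx.
  exists (exist _ e e0) => /=; apply: le_lt_trans (_ : eta / 2 < eta).
    by rewrite ge_min lexx orbT.
  by rewrite gtr_pMr// invf_lt1// ltr1n.
apply: filter_from_filter; first by exists 1 => /=.
move=> a b /= a0 b0; exists (Num.min a b) => /=; first by rewrite lt_min a0.
by move=> e /=; rewrite lt_min => /andP[].
Qed.

Lemma kre_lie_iter xs (h : X -> K) :
  (@kre R s) \o foldr (@lie R s n X) h xs = lie_iter xs (@kre R s \o h).
Proof.
elim: xs => [//|xi xs IH]; apply/funext => p /=.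
by rewrite /lie /kderive kre_pair [in LHS]compA IH.
Qed.

Lemma kim_pair0 (a b : R) : (s = real_scalars -> b = 0) -> kim (kpair s a b) = b.
Proof. by case: s => //= /(_ erefl). Qed.

Lemma kim_lie_iter xs (h : X -> K) :
  (@kim R s) \o foldr (@lie R s n X) h xs = lie_iter xs (@kim R s \o h).
Proof.
elim: xs => [//|xi xs IH]; apply/funext => p /=.
rewrite /lie /kderive kim_pair0; first by rewrite [in LHS]compA IH.
move=> s0; move: (foldr _ _ _); rewrite s0 => k /=; exact: derive_cst.
Qed.

Lemma Ck_CmR k (f : X -> K) m : Ck k f -> order_le m k ->
  CmR m (@kre R s \o f) /\ CmR m (@kim R s \o f).
Proof.
move=> Cf mk; split=> c ac; rewrite chart_traceT; have [re im] := Cf c ac.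
  exact: re.
exact: im.
Qed.

Lemma Cinf_CmR (u : Cinf s X) m : CmR m (@kre R s \o u) /\ CmR m (@kim R s \o u).
Proof. by have /asboolP Cu := Cinf_smooth u; exact: Ck_CmR Cu I. Qed.

(** [proj] is [kre] or [kim]. Uniform smallness of the derivatives of [u - f] on compact sets
    becomes continuous convergence of those of [u], because the derivatives of [f] are continuous
    and may be added back as a constant family. *)
Lemma Ck_associated_proj (proj : K -> R) (u : net s X) (f : X -> K) k :
  (forall x y, proj (x - y) = proj x - proj y) -> (forall x, `|proj x| <= kabs x) ->
  (forall xs (h : X -> K), proj \o foldr (@lie R s n X) h xs = lie_iter xs (proj \o h)) ->
  (forall m, order_le m k -> CmR m (proj \o f)) ->
  (forall m e, CmR m (proj \o u e)) ->
  (forall xi : seq (vector_field X), order_le (size xi) k ->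
    forall L : set X, compact L -> forall d : R, 0 < d ->
    \forall e \near eps0, forall p, L p ->
      kabs (foldr (@lie R s n X) (fun q => u e q - f q) xi p) < d) ->
  forall m, order_le m k -> lie_conv m (@eps0 R) (fun e => proj \o u e) (proj \o f).
Proof.
move=> projB projle projlie Cf Cu unif m mk xs xm.
have ok : order_le (size xs) k.
  by case: k mk {Cf unif} => //= k' mk; exact: leq_trans xm mk.
have Cx : CmR (size xs) (proj \o f) by exact: Cf.
have h0 : cconv (@eps0 R) (fun e => lie_iter xs (proj \o (fun q => u e q - f q))) (fun=> 0).
  apply: uniform_cconv => L cL d d0; have := unif xs ok L cL d d0.
  apply: filterS => e h p Lp; rewrite -projlie /=.
  exact: le_lt_trans (projle _) (h p Lp).
have h2 : cconv (@eps0 R) (fun=> lie_iter xs (proj \o f)) (lie_iter xs (proj \o f)).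
  by apply: cconv_cst; exact: lie_iter_continuous.
apply: cconv_eq (cconvD h0 h2) => [e p|p]; last by rewrite add0r.
have -> : proj \o (fun q => u e q - f q) =
    (fun q => (proj \o u e) q - (proj \o f) q) by apply/funext => q /=; rewrite projB.
by rewrite lie_iterB//= subrK.
Qed.

Lemma lie_conv_Ck_associated (u : net s X) (f : X -> K) k :
  Ck k f ->
  (forall m, order_le m k ->
    lie_conv m (@eps0 R) (fun e => @kre R s \o u e) (@kre R s \o f) /\
    lie_conv m (@eps0 R) (fun e => @kim R s \o u e) (@kim R s \o f)) ->
  forall xi : seq (vector_field X), order_le (size xi) k ->
    forall L : set X, compact L -> forall d : R, 0 < d ->
    \forall e \near eps0, forall p, L p ->
      kabs (foldr (@lie R s n X) (fun q => u e q - f q) xi p) < d.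
Proof.
move=> Cf uf xs ok L cL d d0; have [ufre ufim] := uf _ ok.
have [Cre Cim] := Ck_CmR Cf ok.
have aux (proj : K -> R) :
    (forall x y, proj (x - y) = proj x - proj y) ->
    (forall xs (h : X -> K), proj \o foldr (@lie R s n X) h xs = lie_iter xs (proj \o h)) ->
    CmR (size xs) (proj \o f) -> (forall e, CmR (size xs) (proj \o u e)) ->
    lie_conv (size xs) (@eps0 R) (fun e => proj \o u e) (proj \o f) ->
    \forall e \near eps0, forall p, L p ->
      `|proj (foldr (@lie R s n X) (fun q => u e q - f q) xs p)| < d / 2.
  move=> projB projlie Cpf Cpu conv.
  have h1 := conv xs (leqnn _).
  have h2 : cconv (@eps0 R) (fun=> lie_iter xs (proj \o f)) (lie_iter xs (proj \o f)).
    by apply: cconv_cst; exact: lie_iter_continuous.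
  have h : cconv (@eps0 R) (fun e => lie_iter xs (proj \o (fun q => u e q - f q))) (fun=> 0).
    apply: cconv_eq (cconvB h1 h2) => [e p|p]; last by rewrite subrr.
    have -> : proj \o (fun q => u e q - f q) =
        (fun q => (proj \o u e) q - (proj \o f) q) by apply/funext => q /=; rewrite projB.
    by rewrite lie_iterB.
  have d20 : 0 < d / 2 by rewrite divr_gt0.
  apply: filterS (cconv_uniform h cL d20) => e he p Lp; have := he p Lp.
  by rewrite -projlie.
have are := aux _ kreB kre_lie_iter Cre (fun e => (Cinf_CmR (u e) _).1) ufre.
have aim := aux _ kimB kim_lie_iter Cim (fun e => (Cinf_CmR (u e) _).2) ufim.
apply: filterS (filterI are aim) => e [h1 h2] p Lp.
apply: le_lt_trans (kabs_le _) _; rewrite (splitr d).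
by apply: ltrD; [exact: h1|exact: h2].
Qed.

Lemma Ck_associated_lie_conv (u : net s X) (f : X -> K) k : Ck k f ->
  (forall xi : seq (vector_field X), order_le (size xi) k ->
    forall L : set X, compact L -> forall d : R, 0 < d ->
    \forall e \near eps0, forall p, L p ->
      kabs (foldr (@lie R s n X) (fun q => u e q - f q) xi p) < d) ->
  forall m, order_le m k ->
    lie_conv m (@eps0 R) (fun e => @kre R s \o u e) (@kre R s \o f) /\
    lie_conv m (@eps0 R) (fun e => @kim R s \o u e) (@kim R s \o f).
Proof.
move=> Cf unif m mk; split; apply: Ck_associated_proj unif m mk.
- exact: kreB.
- exact: kre_le.
- exact: kre_lie_iter.
- by move=> m mk; have [] := Ck_CmR Cf mk.
- by move=> m e; have [] := Cinf_CmR (u e) m.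
- exact: kimB.
- exact: kim_le.
- exact: kim_lie_iter.
- by move=> m mk; have [] := Ck_CmR Cf mk.
- by move=> m e; have [] := Cinf_CmR (u e) m.
Qed.

Lemma Ck_mul k (f g : X -> K) : Ck k f -> Ck k g -> Ck k (fun p => f p * g p).
Proof. by move=> Cf Cg c ac; exact: (CkK_on_mul (open_chart_img c) (Cf c ac) (Cg c ac)). Qed.

Lemma negligible0 : @Defs.negligible R s n X (fun=> 0).
Proof.
move=> L cL P dP m; exists 0; apply: nearW => e p Lp.
by rewrite linear0 kabs0 mul0r.
Qed.

Lemma cl_refl (u : net s X) : cl u u.
Proof.
rewrite /cl /= (_ : (fun e => u e - u e) = (fun=> 0)); first exact: negligible0.
by apply/funext => e; rewrite subrr.
Qed.

Lemma colombeau_mul_rep (U V : set (net s X)) u v : U u -> V v ->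
  colombeau_mul U V (fun e => u e * v e).
Proof. by move=> Uu Vv; exists u, v; split=> //; exact: cl_refl. Qed.

Lemma Ck_associated_mul k (U V : set (net s X)) (f g : X -> K) :
  Ck k f -> Ck k g -> Ck_associated k U f -> Ck_associated k V g ->
  Ck_associated k (colombeau_mul U V) (fun p => f p * g p).
Proof.
move=> Cf Cg [u Uu uf] [v Vv vg]; exists (fun e => u e * v e).
  exact: colombeau_mul_rep.
apply: lie_conv_Ck_associated; first exact: Ck_mul.
move=> m mk; have [ur ui] := Ck_associated_lie_conv Cf uf mk.
have [vr vi] := Ck_associated_lie_conv Cg vg mk.
have [fr fi] := Ck_CmR Cf mk; have [gr gi] := Ck_CmR Cg mk.
have Cur e : CmR m (@kre R s \o u e) by exact: (Cinf_CmR _ _).1.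
have Cui e : CmR m (@kim R s \o u e) by exact: (Cinf_CmR _ _).2.
have Cvr e : CmR m (@kre R s \o v e) by exact: (Cinf_CmR _ _).1.
have Cvi e : CmR m (@kim R s \o v e) by exact: (Cinf_CmR _ _).2.
(* [kreM] writes the real part of a product with a factor -1 in front of the imaginary parts; the
   constant family -1 lets the rules for sums and products handle that subtraction. *)
have Cm1 : @CmR R n X m (fun=> -1) by exact: (CmR_on_cst m (-1) openT).
have m1 : lie_conv m (@eps0 R) (fun=> fun=> -1 : R) (fun _ : X => -1 : R).
  move=> xs xm; apply: cconv_cst; apply: lie_iter_continuous; exact: CmR_on_leq Cm1.
have eF : Filter (@eps0 R) by exact: filter_filter.
split.
  have uvi : lie_conv m (@eps0 R) _ _ := lie_convM (FF := eF) Cui Cvi fi gi ui vi.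
  have Cuvi e := CmRM (Cui e) (Cvi e).
  have m1uvi : lie_conv m (@eps0 R) _ _ :=
    lie_convM (FF := eF) (fun=> Cm1) Cuvi Cm1 (CmRM fi gi) m1 uvi.
  have uvr : lie_conv m (@eps0 R) _ _ := lie_convM (FF := eF) Cur Cvr fr gr ur vr.
  have re : lie_conv m (@eps0 R) _ _ :=
    lie_convD (FF := eF) (fun e => CmRM (Cur e) (Cvr e)) (fun e => CmRM Cm1 (Cuvi e))
      (CmRM fr gr) (CmRM Cm1 (CmRM fi gi)) uvr m1uvi.
  by apply: lie_conv_eq re => [e p|p] /=; rewrite kreM.
have uvri : lie_conv m (@eps0 R) _ _ := lie_convM (FF := eF) Cur Cvi fr gi ur vi.
have uvir : lie_conv m (@eps0 R) _ _ := lie_convM (FF := eF) Cui Cvr fi gr ui vr.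
have im : lie_conv m (@eps0 R) _ _ :=
  lie_convD (FF := eF) (fun e => CmRM (Cur e) (Cvi e)) (fun e => CmRM (Cui e) (Cvr e))
    (CmRM fr gi) (CmRM fi gr) uvri uvir.
by apply: lie_conv_eq im => [e p|p] /=; rewrite kimM.
Qed.

End ScalarLie.

(** * Integration of test densities *)

Section BoxIntegral.
Context {R : realType}.
Local Notation mu := (@lebesgue_measure R).

(** The norm of row vectors is the sup norm, so the support lies in a cube and every slice is
    supported in a cube with the same [r]. *)
Definition box_supported {n} (r : R) (g : 'rV[R]_n -> R) : Prop :=
  continuous g /\ forall y, r < `|y| -> g y = 0.

Definition interval_supported (r : R) (h : R -> R) : Prop :=
  continuous h /\ forall t, r < `|t| -> h t = 0.

Lemma interval_supported_integral r h : interval_supported r h ->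
  \int[mu]_t h t = \int[mu]_(t in `[- r, r]) h t.
Proof.
move=> [ch h0]; rewrite [RHS]Rintegral_mkcond; congr (Rintegral _ _ _).
apply/funext => t; rewrite patchE; case: ifPn => //.
rewrite notin_setE /= in_itv /= => /negP tr.
by apply: h0; rewrite ltNge ler_norml.
Qed.

Lemma interval_supported_integrable r h : interval_supported r h ->
  mu.-integrable `[- r, r] (EFin \o h).
Proof.
move=> [ch _]; apply: continuous_compact_integrable; first exact: segment_compact.
exact: continuous_subspaceT.
Qed.

Lemma interval_integralD r f h : interval_supported r f -> interval_supported r h ->
  \int[mu]_t (f t + h t) = \int[mu]_t f t + \int[mu]_t h t.
Proof.
move=> fr hr; have fhr : interval_supported r (fun t => f t + h t).
  split=> [t|t rt]; first by apply: (@continuousD _ _ _ f h); [exact: fr.1|exact: hr.1].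
  by rewrite fr.2// hr.2// addr0.
rewrite !(@interval_supported_integral r)// RintegralD//.
- exact: interval_supported_integrable.
- exact: interval_supported_integrable.
Qed.

Lemma interval_integral_le r M h : 0 <= r -> interval_supported r h ->
  (forall t, `|h t| <= M) -> `|\int[mu]_t h t| <= 2 * r * M.
Proof.
move=> r0 hr hM; rewrite (interval_supported_integral hr).
have ih := interval_supported_integrable hr.
have nr : interval_supported r (fun t => `|h t|).
  split=> [t|t rt]; last by rewrite hr.2// normr0.
  by apply: (@continuous_comp _ _ _ h); [exact: hr.1|exact: norm_continuous].
have cr : mu.-integrable `[- r, r] (EFin \o (fun=> M)).
  apply: continuous_compact_integrable; first exact: segment_compact.
  by apply: continuous_subspaceT => t; exact: cvg_cst.
apply: le_trans (le_normr_Rintegral _ ih) _ => //.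
have le : \int[mu]_(t in `[- r, r]) `|h t| <= \int[mu]_(t in `[- r, r]) M.
  apply: le_Rintegral cr _ => //; exact: interval_supported_integrable nr.
apply: le_trans le _; rewrite Rintegral_cst//= lebesgue_measure_itv /=; case: ifPn => _ /=.
  by rewrite opprK mulrC -mulr2n -[r *+ 2]mulr_natl.
rewrite mulr0 !mulr_ge0//; exact: le_trans (normr_ge0 _) (hM 0).
Qed.

Definition cons_row {m} (t : R) (y : 'rV[R]_m) : 'rV[R]_m.+1 :=
  row_mx (const_mx t : 'rV[R]_1) y.

Lemma cons_row_norml m t (y : 'rV[R]_m) : `|t| <= `|cons_row t y|.
Proof.
have := rV_coord_le (cons_row t y) (lshift m (0 : 'I_1)).
by rewrite /cons_row (row_mxEl (const_mx t : 'rV[R]_1) y) mxE.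
Qed.

Lemma cons_row_normr m t (y : 'rV[R]_m) : `|y| <= `|cons_row t y|.
Proof.
apply: rV_norm_le => // i; have := rV_coord_le (cons_row t y) (rshift 1 i).
by rewrite /cons_row (row_mxEr (const_mx t : 'rV[R]_1) y).
Qed.

Lemma cons_row_continuous m : continuous (fun z : R * 'rV[R]_m => cons_row z.1 z.2).
Proof.
move=> z; apply: continuous_row => i.
have [j ij|j ij] := splitP (i : 'I_(1 + m)).
  have -> : i = lshift m j by exact/val_inj.
  rewrite (_ : (fun _ => _) = fst); first exact: cvg_fst.
  by apply/funext => x; rewrite /cons_row (row_mxEl (const_mx x.1 : 'rV[R]_1)) mxE.
have -> : i = rshift 1 j by exact/val_inj.
rewrite (_ : (fun _ => _) = (fun y : 'rV[R]_m => y 0 j) \o snd).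
  by apply: continuous_comp; [exact: cvg_snd|exact: coord_continuous].
by apply/funext => x; rewrite /cons_row (row_mxEr (const_mx x.1 : 'rV[R]_1)).
Qed.

Lemma integral_rVS m (g : 'rV[R]_m.+1 -> R) :
  integral_rV g = \int[mu]_t integral_rV (fun y => g (cons_row t y)).
Proof. by []. Qed.

Lemma box_slice m r (g : 'rV[R]_m.+1 -> R) t : box_supported r g ->
  box_supported r (fun y => g (cons_row t y)).
Proof.
move=> [cg g0]; split=> [y|y ry].
  apply: (@continuous_comp _ _ _ (fun y => cons_row t y) g); last exact: cg.
  apply: (@continuous_comp _ _ _ (fun y => (t, y)) (fun z => cons_row z.1 z.2)).
    move=> A [[U V] /= [tU yV] UV]; apply: filterS yV => z Vz.
    by apply: UV; split=> //=; exact: nbhs_singleton tU.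
  exact: cons_row_continuous.
by apply: g0; apply: lt_le_trans ry _; exact: cons_row_normr.
Qed.

Lemma boxB n r (f g : 'rV[R]_n -> R) : box_supported r f -> box_supported r g ->
  box_supported r (fun y => f y - g y).
Proof.
move=> [cf f0] [cg g0]; split=> [y|y ry]; last by rewrite f0// g0// subr0.
by apply: (@continuousB _ _ _ f g); [exact: cf|exact: cg].
Qed.

Lemma compact_norm_le m r : compact [set y : 'rV[R]_m | `|y| <= r].
Proof.
apply: bounded_closed_compact.
  by exists r; split; [exact: num_real|move=> M rM y /= /le_trans; apply; exact: ltW].
apply: (@closed_comp _ _ (fun y : 'rV[R]_m => `|y|) [set x | x <= r]).
  by move=> y _; exact: norm_continuous.
exact: closed_le.
Qed.

(** Continuity at the points [(t0, y)] is uniform for [y] in the compact ball of radius [r], and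
    beyond that ball both slices vanish. *)
Lemma box_slice_uniform m r (g : 'rV[R]_m.+1 -> R) t0 d : box_supported r g ->
  0 < d -> \forall t \near t0, forall y,
    `|g (cons_row t y) - g (cons_row t0 y)| < d.
Proof.
move=> bg d0; pose B := [set y : 'rV[R]_m | `|y| <= r].
have cB : compact B by exact: compact_norm_le.
have gc (z : R * 'rV[R]_m) : {for z, continuous (fun z : R * 'rV[R]_m => g (cons_row z.1 z.2))}.
  apply: (@continuous_comp _ _ _ (fun z : R * 'rV[R]_m => cons_row z.1 z.2) g).
    exact: cons_row_continuous.
  exact: bg.1.
have d20 : 0 < d / 2 by rewrite divr_gt0.
move/compact_near_coveringP: cB => /(_ R (nbhs t0)
  (fun t y => `|g (cons_row t y) - g (cons_row t0 y)| < d) _) cB.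
have : \forall t \near t0, B `<=` (fun y => `|g (cons_row t y) - g (cons_row t0 y)| < d).
  apply: cB => y _.
  have /cvgrPdist_lt/(_ _ d20) [[U V] /= [t0U yV] UV] := gc (t0, y).
  exists (V, U) => //= -[y' t] [/= Vy' Ut].
  have h1 := UV (t, y') (conj Ut Vy'); have h2 := UV (t0, y') (conj (nbhs_singleton t0U) Vy').
  rewrite -(subrKA (g (cons_row t0 y))) (le_lt_trans (ler_normD _ _))// (splitr d).
  by rewrite ltrD// distrC.
apply: filterS => t tB y; have [yr|yr] := leP `|y| r; first exact: tB.
by rewrite !(box_slice _ bg).2// subrr normr0.
Qed.

(** Additivity and the bound share one induction: the inner integral must be continuous in [t]
    before it can be integrated, and this follows by applying both properties to the difference of
    two slices. *)
Lemma integral_rV_box n r : 0 <= r ->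
  (forall f g : 'rV[R]_n -> R, box_supported r f -> box_supported r g ->
    integral_rV (fun y => f y + g y) = integral_rV f + integral_rV g) /\
  (forall (g : 'rV[R]_n -> R) M, box_supported r g -> (forall y, `|g y| <= M) ->
    `|integral_rV g| <= (2 * r) ^+ n * M).
Proof.
move=> r0; elim: n => [|m [ID IB]].
  by split=> // g M _ gM /=; rewrite expr0 mul1r.
have slice (g : 'rV[R]_m.+1 -> R) : box_supported r g ->
    interval_supported r (fun t => integral_rV (fun y => g (cons_row t y))).
  move=> bg; split=> [t0|t rt].
    (* The added 1 keeps [C] positive when the volume of the cube is 0. *)
    apply/cvgrPdist_le => d d0; pose C := (2 * r) ^+ m + 1.
    have C0 : 0 < C by rewrite ltr_wpDl// exprn_ge0// mulr_ge0.
    have dC : 0 < d / C by rewrite divr_gt0.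
    apply: filterS (box_slice_uniform t0 bg dC) => t ht.
    have bt := box_slice t bg; have bt0 := box_slice t0 bg.
    have := ID _ _ (boxB bt bt0) bt0; under [in LHS]eq_fun do rewrite subrK.
    move=> ->; rewrite opprD addrCA subrr addr0 normrN.
    have := IB _ (d / C) (boxB bt bt0) (fun y => ltW (ht y)).
    move=> /le_trans; apply; rewrite mulrCA ger_pMr// ler_pdivrMr// mul1r.
    by rewrite lerDl.
  apply/eqP; rewrite -normr_le0.
  have := IB _ 0 (box_slice t bg); rewrite mulr0; apply=> y.
  by rewrite bg.2 ?normr0//; apply: lt_le_trans rt _; exact: cons_row_norml.
split=> [f g bf bg|g M bg gM].
  rewrite !integral_rVS -(interval_integralD (slice f bf) (slice g bg)).
  congr (Rintegral _ _ _); apply/funext => t.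
  exact: ID (box_slice t bf) (box_slice t bg).
rewrite integral_rVS exprS -mulrA; apply: interval_integral_le => //; first exact: slice.
by move=> t; apply: IB => //; exact: box_slice.
Qed.

Lemma integral_rV0 n : integral_rV (fun _ : 'rV[R]_n => 0 : R) = 0.
Proof.
have bz : box_supported 0 (fun _ : 'rV[R]_n => 0 : R).
  by split=> // y; exact: (@cvg_cst _ _ _ _ (nbhs_filter y)).
apply/eqP; rewrite -normr_le0 -[leRHS](mulr0 ((2 * 0) ^+ n)).
by apply: (integral_rV_box n (lexx (0 : R))).2 => // y; rewrite normr0.
Qed.

End BoxIntegral.

Lemma compact_finite_cover (T : topologicalType) (L : set T) (W : T -> set T) :
  compact L -> (forall x, nbhs x (W x)) ->
  exists D : seq T, forall x, L x -> exists2 z, z \in D & W z x.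
Proof.
move=> /compact_near_coveringP cL nW.
(* The parameters of the near-covering property are the finite lists, directed by inclusion: every
   list containing [x] covers the points of [W x]. *)
pose F : set_system (seq T) :=
  filter_from setT (fun D0 : seq T => [set D : seq T | {subset D0 <= D}]).
have FF : Filter F.
  apply: filter_from_filter; first by exists [::].
  move=> A B _ _; exists (A ++ B) => // D AB.
  by split=> z zD; apply: AB; rewrite mem_cat zD ?orbT.
have [|D _ LD] := cL _ F (fun (D : seq T) x => exists2 z, z \in D & W z x) FF.
  move=> x Lx; exists (W x, [set D : seq T | x \in D]) => /=.
    by split=> //; exists [:: x] => // D; apply; exact: mem_head.
  by move=> [x' D] /= [Wx xD]; exists x.
by exists D => x Lx; exact: (LD D (fun=> id) x Lx).
Qed.

(** * Reduction of the integral of a density to finitely many box integrals *)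

Section DensityIntegral.
Context {R : realType} {s : scalar_kind} {n : nat} {X : manifold R n}.
Local Notation K := (scalars R s).
Implicit Types (mu nu : test_density s X) (L : set X).

Lemma locally_finite_compact (F : X -> set X) L :
  locally_finite setT F -> compact L -> finite_set [set q | (F q `&` L) !=set0].
Proof.
move=> lF cL; pose W x := projT1 (cid2 (lF x)).
have nW x : nbhs x (W x) by rewrite /W; case: cid2.
have fW x : finite_set [set q | (F q `&` W x) !=set0].
  rewrite /W; case: cid2 => V _ /=; apply: sub_finite_set => q h; split=> //.
have [D LD] := compact_finite_cover cL nW.
apply: (@sub_finite_set _ _ (\bigcup_(x in [set` D]) [set q | (F q `&` W x) !=set0])).
  by move=> q [p [Fp /LD[z zD Wzp]]]; exists z => //; exists p.
by apply: bigcup_finite => //; exact: finite_seq.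
Qed.

Lemma box_bounded m r (g : 'rV[R]_m -> R) : box_supported r g ->
  exists2 C, 0 <= C & forall y, `|g y| <= C.
Proof.
move=> bg; pose B := [set y : 'rV[R]_m | `|y| <= r].
have cB : compact B by exact: compact_norm_le.
have cgB : compact (g @` B).
  by apply: continuous_compact cB; apply: continuous_subspaceT; exact: bg.1.
have [M [_ gM]] := compact_bounded cgB.
exists (`|M| + 1); first by rewrite addr_ge0.
move=> y; have [yr|yr] := leP `|y| r.
  apply: gM; last by exists y.
  by rewrite ltr_pwDr// ler_norm.
by rewrite bg.2// normr0 addr_ge0.
Qed.

Lemma kabs_pair_le (a b : R) : kabs (kpair s a b) <= `|a| + `|b|.
Proof.
apply: le_trans (kabs_le _) _; rewrite kre_pair lerD2l.
by case: s; rewrite /= ?normr0.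
Qed.

Lemma kre_scale (c : R) (z : K) : kre (kpair s c 0 * z) = c * kre z.
Proof.
rewrite kreM kre_pair kim_pair0//.
by rewrite mul0r mulr0 addr0.
Qed.

Lemma kim_scale (c : R) (z : K) : kim (kpair s c 0 * z) = c * kim z.
Proof. by rewrite kimM kre_pair kim_pair0// mul0r addr0. Qed.

Section Partition.
Variable chi : X -> X -> R.
Hypothesis chiP : partition_of_unity chi.

Definition weighted_coord q (nu : X -> K) : 'rV[R]_n -> K :=
  (fun y => kpair s (chi q (chart_inv (chart_at q) y)) 0 *
            dens_coord (chart_at q) nu (chart_inv (chart_at q) y))
    \_ (chart_img (chart_at q)).

Lemma weighted_coordD q (mu nu : X -> K) y :
  weighted_coord q (fun p => mu p + nu p) y =
  weighted_coord q mu y + weighted_coord q nu y.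
Proof.
rewrite /weighted_coord !patchE; case: ifP => _; last by rewrite addr0.
by rewrite /dens_coord !mulrDr.
Qed.

Lemma weighted_coord_dom q (mu nu : X -> K) M y : 0 <= M ->
  (forall p, kabs (nu p) <= M * kabs (mu p)) ->
  kabs (weighted_coord q nu y) <= M * kabs (weighted_coord q mu y).
Proof.
move=> M0 h; rewrite /weighted_coord !patchE; case: ifP => _; last first.
  by rewrite kabs0 mulr0.
rewrite /dens_coord !kabsM !mulrA [M * _]mulrC.
rewrite -!mulrA ler_wpM2l ?kabs_ge0// mulrCA ler_wpM2l ?kabs_ge0//.
Qed.

Lemma weighted_coord_out q L (nu : X -> K) y : (forall p, ~ L p -> nu p = 0) ->
  ~ (chart_at q @` (supp (chi q) `&` L)) y -> weighted_coord q nu y = 0.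
Proof.
move=> nuL yK; rewrite /weighted_coord patchE; case: ifPn => // /set_mem yi.
have [Lp|Lp] := pselect (L (chart_inv (chart_at q) y)); last first.
  by rewrite /dens_coord nuL// !mulr0.
have [->|c0] := eqVneq (chi q (chart_inv (chart_at q) y)) 0.
  by rewrite kpair00 mul0r.
exfalso; apply: yK; exists (chart_inv (chart_at q) y); last exact: chart_invK.
by split=> //; apply: subset_closure.
Qed.

(** The integrand is cut off at the edge of the chart image, yet it is continuous: it vanishes off
    the image of [supp (chi q)]&[L], a compact and hence closed subset of the chart image. This
    compact set also provides [r], which therefore serves all [nu] living on [L]. *)
Lemma weighted_coord_box q L : compact L -> exists2 r, 0 <= r &
  forall nu : X -> K, smooth_density nu -> (forall p, ~ L p -> nu p = 0) ->
    box_supported r (@kre R s \o weighted_coord q nu) /\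
    box_supported r (@kim R s \o weighted_coord q nu).
Proof.
move=> cL; have [chi_smooth _ chi_dom _ _] := chiP.
pose c := chart_at q; pose Kq := c @` (supp (chi q) `&` L).
have cK : compact (supp (chi q) `&` L).
  by rewrite setIC; apply: compact_closedI => //; exact: closed_closure.
have cKq : compact Kq.
  apply: continuous_compact cK; apply: continuous_in_subspaceT => p /set_mem[/chi_dom cp _].
  exact: (@chart_map_continuous _ _ _ c p cp).
have clKq : closed Kq by apply: compact_closed cKq; exact: norm_hausdorff.
have [M [_ KM]] := compact_bounded cKq.
exists (`|M| + 1); first by rewrite addr_ge0.
move=> nu snu nuL; have Kr y : Kq y -> `|y| <= `|M| + 1.
  by move=> Ky; apply: KM => //; rewrite ltr_pwDr// ler_norm.
have out y : `|M| + 1 < `|y| -> weighted_coord q nu y = 0.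
  move=> yM; apply: (weighted_coord_out nuL) => /Kr.
  by rewrite leNgt yM.
have [Cre Cim] := snu c (atlas_chart_at q).
have chic : Ck_on None (chart_img c) (chi q \o chart_inv c).
  exact: chi_smooth (atlas_chart_at q).
have oc := open_chart_img c.
have ctn (proj : K -> R) : proj 0 = 0 -> (forall a z, proj (kpair s a 0 * z) = a * proj z) ->
    Ck_on None (chart_img c) (proj \o (dens_coord c nu \o chart_inv c)) ->
    continuous (proj \o weighted_coord q nu).
  move=> proj0 projM Cp y; have [cy|cy] := pselect (chart_img c y).
    have Cprod := Cm_on_mul oc (chic 0%N I) (Cp 0%N I).
    have := Cm_on_continuous Cprod cy.
    rewrite /prop_for /continuous_at /= {2}/weighted_coord patchE mem_set// projM.
    apply: cvg_trans; apply: (@near_eq_cvg _ _ (nbhs y) (nbhs_filter y)).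
    have : nbhs y (chart_img c) by exact: open_nbhs_nbhs.
    by apply: filterS => z cz /=; rewrite /weighted_coord patchE mem_set// projM.
  have yK : (~` Kq) y.
    by move=> [p [/chi_dom cp _] py]; apply: cy; rewrite -py; exact: chart_imgP.
  have E z : (~` Kq) z -> (proj \o weighted_coord q nu) z = 0.
    by move=> zK; rewrite /= (weighted_coord_out nuL zK).
  rewrite /continuous_at (E y yK); apply: (@cvg_trans _ ((fun=> 0 : R) @ nbhs y)).
    apply: (@near_eq_cvg _ _ (nbhs y) (nbhs_filter y)).
    have : nbhs y (~` Kq) by apply: open_nbhs_nbhs; split=> //; exact: closed_openC.
    by apply: filterS => z /E ->.
  exact: (@cvg_cst _ _ _ _ (nbhs_filter y)).
split; split.
- by apply: ctn Cre; [exact: kre0|exact: kre_scale].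
- by move=> y yM; rewrite /= out// kre0.
- by apply: ctn Cim; [exact: kim0|exact: kim_scale].
- by move=> y yM; rewrite /= out// kim0.
Qed.

Lemma kintegralD r (f g : 'rV[R]_n -> K) : 0 <= r ->
  box_supported r (@kre R s \o f) -> box_supported r (@kim R s \o f) ->
  box_supported r (@kre R s \o g) -> box_supported r (@kim R s \o g) ->
  kintegral (fun y => f y + g y) = kintegral f + kintegral g.
Proof.
move=> r0 fr fi gr gi; have [ID _] := integral_rV_box n r0.
rewrite /kintegral kpairD -(ID _ _ fr gr) -(ID _ _ fi gi).
by congr (kpair s _ _); congr (integral_rV _); apply/funext => y /=;
  rewrite ?kreD ?kimD.
Qed.

Lemma kintegral_le r (f : 'rV[R]_n -> K) M : 0 <= r ->
  box_supported r (@kre R s \o f) -> box_supported r (@kim R s \o f) ->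
  (forall y, kabs (f y) <= M) ->
  kabs (kintegral f) <= 2 * (2 * r) ^+ n * M.
Proof.
move=> r0 fr fi fM; have [_ IB] := integral_rV_box n r0.
apply: le_trans (kabs_pair_le _ _) _.
rewrite -mulrA mulr_natl mulr2n; apply: lerD.
  by apply: IB => // y; apply: le_trans (fM y); exact: kre_le.
by apply: IB => // y; apply: le_trans (fM y); exact: kim_le.
Qed.

(** Local finiteness leaves finitely many supports meeting [L]. The list depends on [L] only, so
    different densities can be compared term by term. *)
Lemma partition_sumE L : compact L -> exists D : seq X,
  forall nu : X -> K, (forall p, ~ L p -> nu p = 0) ->
    \sum_(q \in [set: X]) kintegral (weighted_coord q nu) =
    \sum_(q <- D) kintegral (weighted_coord q nu).
Proof.
move=> cL; have [_ _ _ lf _] := chiP.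
have fQ := locally_finite_compact lf cL.
exists (finmap.enum_fset (fset_set [set q | (supp (chi q) `&` L) !=set0])) => nu nuL.
apply: fsbigTE => q; rewrite in_fset_set// notin_setE /= => qL.
have E y : weighted_coord q nu y = 0.
  by apply: (weighted_coord_out nuL) => -[p pK _]; apply: qL; exists p.
rewrite /kintegral -[RHS]kpair00 -[in RHS](integral_rV0 n).
by congr (kpair s _ _); congr (integral_rV _); apply/funext => y /=;
  rewrite E ?kre0 ?kim0.
Qed.

End Partition.
End DensityIntegral.

Section IntegralDensity.
Context {R : realType} {s : scalar_kind} {n : nat} {X : manifold R n}.
Local Notation K := (scalars R s).
Implicit Types (mu nu : test_density s X).

(* If there were no partition of unity, [chosen_partition] would be the default
   value 0 and all integrals would vanish: existence is never needed. *)
Lemma chosen_partitionP :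
  partition_of_unity (@chosen_partition R n X) \/
  forall mu, integral_density mu = 0.
Proof.
have [[chi chiP]|nochi] := pselect (exists chi, partition_of_unity (X:=X) chi).
  by left; apply: (xgetPex (fun _ _ => 0)); exists chi.
right=> mu; rewrite /integral_density /chosen_partition xgetPN; last first.
  by move=> chi chiP; apply: nochi; exists chi.
apply: fsbig1 => q _; rewrite /kintegral -[RHS]kpair00 -[in RHS](integral_rV0 n).
have E y : ((fun y => kpair s 0 0 * dens_coord (chart_at q) mu (chart_inv (chart_at q) y))
    \_ (chart_img (chart_at q))) y = kpair s 0 0.
  by rewrite patchE kpair00 mul0r; case: ifP.
by congr (kpair s _ _); congr (integral_rV _); apply/funext => y /=;
  rewrite E ?kre_pair ?kim_pair0.
Qed.

Lemma supp_out (A : zmodType) (f : X -> A) p : ~ supp f p -> f p = 0.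
Proof.
by move=> pf; apply/eqP; apply: contra_notT pf => fp; exact: subset_closure.
Qed.

Lemma test_density_smooth mu : smooth_density mu.
Proof. by have /asboolP[] := dens_test mu. Qed.

Lemma test_density_compact mu : compact (supp mu).
Proof. by have /asboolP[] := dens_test mu. Qed.

Lemma integral_densityD mu nu :
  integral_density (mu + nu) = integral_density mu + integral_density nu.
Proof.
have [chiP|I0] := chosen_partitionP; last by rewrite !I0 addr0.
have cL := compactU (@test_density_compact mu) (@test_density_compact nu).
have [D DE] := partition_sumE (s := s) chiP cL.
have muL p : ~ (supp mu `|` supp nu) p -> mu p = 0 :> K.
  by move=> pL; apply: supp_out => h; apply: pL; left.
have nuL p : ~ (supp mu `|` supp nu) p -> nu p = 0 :> K.
  by move=> pL; apply: supp_out => h; apply: pL; right.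
have munuL p : ~ (supp mu `|` supp nu) p -> (mu + nu) p = 0 :> K.
  by move=> pL; rewrite [LHS](_ : _ = mu p + nu p)// muL// nuL// addr0.
rewrite /integral_density [LHS](DE _ munuL).
rewrite [X in _ = X + _](DE _ muL) [X in _ = _ + X](DE _ nuL).
rewrite -big_split /=; apply: eq_bigr => q _.
have [r r0 box] := weighted_coord_box (s := s) chiP q cL.
have [mre mim] := box _ (@test_density_smooth mu) muL.
have [nre nim] := box _ (@test_density_smooth nu) nuL.
rewrite -(kintegralD r0 mre mim nre nim); congr (kintegral _).
by apply/funext => y; rewrite -weighted_coordD.
Qed.

(** Domination by [mu] forces [nu] to vanish off [supp mu], so the charts and the cubes are those of
    [mu], and in each chart the integrand of [nu] is at most [M] times the bounded integrand of
    [mu]. Every smallness estimate for integrals goes through this bound. *)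
Lemma integral_density_dom mu : exists2 C, 0 <= C &
  forall nu M, 0 <= M -> (forall p, kabs (nu p : K) <= M * kabs (mu p : K)) ->
    kabs (integral_density nu) <= C * M.
Proof.
have [chiP|I0] := chosen_partitionP; last first.
  by exists 0 => // nu M M0 _; rewrite I0 kabs0 mul0r.
have cL := @test_density_compact mu; have muL := @supp_out _ mu.
have [D DE] := partition_sumE (s := s) chiP cL.
have dom0 nu M : (forall p, kabs (nu p : K) <= M * kabs (mu p : K)) ->
    forall p, ~ supp mu p -> nu p = 0 :> K.
  by move=> num p /muL mp; apply: kabs_eq0; rewrite (le_trans (num p))// mp kabs0 mulr0.
have Cq q : exists2 C, 0 <= C & forall nu M, 0 <= M ->
    (forall p, kabs (nu p : K) <= M * kabs (mu p : K)) ->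
    kabs (kintegral (weighted_coord (@chosen_partition R n X) q nu)) <= C * M.
  have [r r0 box] := weighted_coord_box (s := s) chiP q cL.
  have [mre mim] := box _ (@test_density_smooth mu) muL.
  have [C1 C10 C1P] := box_bounded mre; have [C2 C20 C2P] := box_bounded mim.
  exists (2 * (2 * r) ^+ n * (C1 + C2)).
    by rewrite mulr_ge0 ?addr_ge0 ?mulr_ge0 ?exprn_ge0 ?mulr_ge0.
  move=> nu M M0 num.
  have nuL := dom0 nu M num.
  have [nre nim] := box _ (@test_density_smooth nu) nuL.
  rewrite -mulrA; apply: (kintegral_le r0 nre nim) => y.
  apply: le_trans (@weighted_coord_dom _ s _ _ _ q mu nu M y M0 num) _.
  rewrite mulrC ler_wpM2r//; apply: le_trans (kabs_le _) _; apply: lerD.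
    exact: C1P.
  exact: C2P.
pose C q := projT1 (cid2 (Cq q)).
have C0 q : 0 <= C q by rewrite /C; case: cid2.
exists (\sum_(q <- D) C q); first by apply: sumr_ge0.
move=> nu M M0 num.
have nuL := dom0 nu M num.
rewrite /integral_density (DE _ nuL) mulr_suml.
elim: D {DE} => [|q D IH]; first by rewrite !big_nil kabs0.
rewrite !big_cons; apply: le_trans (kabsD _ _) _; apply: lerD => //.
by rewrite /C; case: cid2 => c /= _; apply.
Qed.

End IntegralDensity.

(** * Gliding hump *)

Section GlidingHump.
Context {R : realType} {s : scalar_kind}.
Local Notation K := (scalars R s).
Context {I : Type} {F : set_system I} {FF : Filter F} {Z : zmodType}.
Variables (Phi : I -> Z -> K) (w : Z -> K) (z : I -> Z).
Hypothesis PhiD : forall e x y, Phi e (x + y) = Phi e x + Phi e y.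
Hypothesis Phi_cvg : forall x, Phi e x @[e --> F] --> w x.
Hypothesis Phi_z : forall e, Phi e (z e') @[e' --> F] --> 0.
(** [base k] collects the demands on the k-th index. The hypotheses below stand in for a topology on
    [Z]: [summable] asks for a sum of the series of [z (ee i)] only as seen by each single
    functional [Phi e]. *)
Variable base : nat -> set I.
Hypothesis F_base : forall k, F (base k).
Hypothesis base_cofinal : forall ee : nat -> I, (forall k, base k (ee k)) ->
  ee k @[k --> \oo] --> F.
Hypothesis summable : forall ee : nat -> I, (forall k, base k (ee k)) ->
  exists x, forall e, Phi e (x - \sum_(i < N) z (ee i)) @[N --> \oo] --> 0.

Let PhiB e x y : Phi e (x - y) = Phi e x - Phi e y.
Proof. by apply/eqP; rewrite eq_sym subr_eq -PhiD subrK. Qed.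

(* Indices are chosen in pairs: e1 k is only close to the limit on the partial
   sum built so far, e2 k is moreover bad.  On the full sum x the values of
   Phi (e1 k) and Phi (e2 k) then differ by almost delta, although both tend
   to w x. *)
Lemma gliding_hump : Phi e (z e) @[e --> F] --> 0.
Proof.
apply/kcvgP => delta delta0; apply: contrapT => nearN.
have often A : F A -> exists2 e, A e & delta <= kabs (Phi e (z e)).
  move=> FA; apply: contrapT => noe; apply: nearN; apply: filterS FA => e Ae.
  rewrite subr0 ltNge; apply/negP => le; by apply: noe; exists e.
(* In the final decomposition two tails cost [2 * eta] each and four comparisons with [w] cost [eta]
   each, in all [delta / 2]. *)
pose eta := delta / 16; have eta0 : 0 < eta by rewrite divr_gt0.
(* [st] holds the sum so far and the list of all indices used. The new hump [z p.2] must be nearly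
   invisible to the functionals of the earlier indices and of [p.1], but large for its own. *)
pose good (k : nat) (st : Z * seq I) (p : I * I) := [/\ base k p.1, base k p.2,
  kabs (Phi p.1 st.1 - w st.1) < eta, kabs (Phi p.2 st.1 - w st.1) < eta &
  delta <= kabs (Phi p.2 (z p.2)) /\
  forall i, (i < (size st.2).+1)%N ->
    kabs (Phi (nth p.1 (p.1 :: st.2) i) (z p.2)) < eta / 2 ^+ k.+1].
have step (x : nat * (Z * seq I)) : exists p, good x.1 x.2 p.
  case: x => k [t l] /=.
  have /kcvgP/(_ _ eta0) near_t := @Phi_cvg t.
  pose A := base k `&` [set e | kabs (Phi e t - w t) < eta].
  have FA : F A by exact: filterI.
  (* [often] serves here only to produce a point of [A]; that the point is bad is discarded. *)
  have [e1 [be1 te1] _] := often A FA.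
  have eta2 : 0 < eta / 2 ^+ k.+1 by rewrite divr_gt0// exprn_gt0.
  have FB : F [set e | forall i : 'I_(size l).+1,
      kabs (Phi (nth e1 (e1 :: l) i) (z e)) < eta / 2 ^+ k.+1].
    apply: (@filter_forall _ _ (fun (i : 'I_(size l).+1) e =>
      kabs (Phi (nth e1 (e1 :: l) i) (z e)) < eta / 2 ^+ k.+1)) => i.
    have /kcvgP/(_ _ eta2) := @Phi_z (nth e1 (e1 :: l) i).
    by apply: filterS => e; rewrite subr0.
  have [e2 [[be2 te2] e2l] e2d] := often _ (filterI FA FB).
  by exists (e1, e2); split=> //; split=> // i il; exact: (e2l (Ordinal il)).
have [pick pickP] := choice step.
pose next k (st : Z * seq I) := let p := pick (k, st) in
  (st.1 + z p.2, [:: p.2, p.1 & st.2]).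
pose fix st k := if k is k'.+1 then next k' (st k') else (0 : Z, [::] : seq I).
pose e1 k := (pick (k, st k)).1; pose e2 k := (pick (k, st k)).2.
have gd k : good k (st k) (e1 k, e2 k).
  by have := pickP (k, st k); rewrite /e1 /e2; case: (pick _).
have stS k : st k.+1 = ((st k).1 + z (e2 k), [:: e2 k, e1 k & (st k).2]) by [].
have sumE k : (st k).1 = \sum_(i < k) z (e2 i).
  elim: k => [|k IH]; first by rewrite big_ord0.
  by rewrite stS big_ord_recr /= IH.
have mem_e1 k m : (k < m)%N -> forall d : I,
    exists2 i, (i < size (st m).2)%N & nth d (st m).2 i = e1 k.
  elim: m => [//|m IH]; rewrite ltnS leq_eqVlt => /predU1P[-> d|km d].
    by exists 1%N.
  by have [i im E] := IH km d; exists i.+2.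
have mem_e2 k m : (k < m)%N -> forall d : I,
    exists2 i, (i < size (st m).2)%N & nth d (st m).2 i = e2 k.
  elim: m => [//|m IH]; rewrite ltnS leq_eqVlt => /predU1P[-> d|km d].
    by exists 0%N.
  by have [i im E] := IH km d; exists i.+2.
(* The case [k = m] belongs to [e1] only, since [e2 k] is bad on its own hump. Hence the tail seen
   by [e1 k] starts at [k], and the one seen by [e2 k] at [k.+1]. *)
have small1 k m : (k <= m)%N -> kabs (Phi (e1 k) (z (e2 m))) < eta / 2 ^+ m.+1.
  have [_ _ _ _ [_ h]] := gd m; rewrite leq_eqVlt => /predU1P[->|km]; first exact: (h 0%N).
  by have [i im <-] := mem_e1 _ _ km (e1 m); exact: (h i.+1).
have small2 k m : (k < m)%N -> kabs (Phi (e2 k) (z (e2 m))) < eta / 2 ^+ m.+1.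
  have [_ _ _ _ [_ h]] := gd m => km.
  by have [i im <-] := mem_e2 _ _ km (e1 m); exact: (h i.+1).
have [x xP] := summable (fun k => let: And5 _ b _ _ _ := gd k in b).
have half N : eta / 2 ^+ N = eta / 2 ^+ N.+1 + eta / 2 ^+ N.+1.
  by rewrite exprS invfM mulrA -mulrDl -splitr.
(* One [eta] pays for the geometric series of humps up to a late partial sum, the other for
   replacing that partial sum by [x]. *)
have tail j m : (forall i, (m <= i)%N -> kabs (Phi j (z (e2 i))) < eta / 2 ^+ i.+1) ->
    kabs (Phi j x - Phi j (st m).1) <= 2 * eta.
  move=> jm.
  have partial N : (m <= N)%N ->
      kabs (Phi j (st N).1 - Phi j (st m).1) <= eta / 2 ^+ m - eta / 2 ^+ N.
    move=> /subnK <-; elim: (N - m)%N => [|t IH]; first by rewrite !subrr kabs0.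
    rewrite addSn stS PhiD [_ + Phi j _]addrC -addrA.
    apply: le_trans (kabsD _ _) _.
    have := jm (t + m)%N (leq_addl _ _); have := half (t + m)%N; move: IH.
    by set y := eta / 2 ^+ (t + m).+1; set y' := eta / 2 ^+ (t + m); lra.
  have /kcvgP/(_ _ eta0)[N _ Nx] := @xP j.
  have := Nx (maxn N m) (leq_maxl _ _); rewrite subr0 -sumE PhiB => /ltW h1.
  have h2 := partial (maxn N m) (leq_maxr _ _).
  rewrite -(subrKA (Phi j (st (maxn N m)).1)).
  apply: le_trans (kabsD _ _) _; rewrite mulr_natl mulr2n lerD//.
  apply: le_trans h2 _; rewrite lerBlDr; apply: le_trans (_ : eta <= _).
    by rewrite ler_pdivrMr ?exprn_gt0// ler_pMr// exprn_ege1// ler1n.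
  by rewrite lerDl divr_ge0 ?ltW// exprn_ge0.
have /kcvgP wx := @Phi_cvg x.
have c1 : e1 k @[k --> \oo] --> F.
  by apply: base_cofinal => k; have [] := gd k.
have c2 : e2 k @[k --> \oo] --> F.
  by apply: base_cofinal => k; have [] := gd k.
have n1 : \forall k \near \oo, kabs (Phi (e1 k) x - w x) < eta.
  exact: (c1 _ (wx _ eta0)).
have n2 : \forall k \near \oo, kabs (Phi (e2 k) x - w x) < eta.
  exact: (c2 _ (wx _ eta0)).
have [k [h1 h2]] := filter_ex (filterI n1 n2); have [_ _ g1 g2 [g _]] := gd k.
have t1 := tail (e1 k) k (fun i => @small1 k i).
have t2 := tail (e2 k) k.+1 (fun i => @small2 k i).
(* The hump is the difference of two consecutive partial sums; [w x], [w (st k).1] and the values of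
   [Phi (e1 k)] are inserted and cancel. *)
have E : Phi (e2 k) (z (e2 k)) =
    - (Phi (e2 k) x - Phi (e2 k) (st k.+1).1) + (Phi (e2 k) x - w x)
    + - (Phi (e1 k) x - w x) + (Phi (e1 k) x - Phi (e1 k) (st k).1)
    + (Phi (e1 k) (st k).1 - w (st k).1) + - (Phi (e2 k) (st k).1 - w (st k).1).
  by rewrite stS PhiD; ring.
move: g; rewrite E leNgt => /negP; apply.
have aux (a b c d e f : K) : kabs (a + b + c + d + e + f) <=
    kabs a + kabs b + kabs c + kabs d + kabs e + kabs f.
  by do 5 (apply: le_trans (kabsD _ _) _; rewrite lerD2r).
apply: le_lt_trans (aux _ _ _ _ _ _) _; rewrite !kabsN.
by move: t1 t2 h1 h2 g1 g2; rewrite /eta; move: delta0; lra.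
Qed.

End GlidingHump.

(** * Smoothness of limits *)

Section LimitDerivative.
Context {R : realType} {V : normedModType R}.

(** The mean value theorem turns a difference quotient of [phi N] at [y] into a derivative at a
    nearby point, which is close to [l] for all late [N] at once; letting [N] grow gives the same
    bound for the quotient of [f]. *)
Lemma is_derive_limit (O : set V) (phi : nat -> V -> R) (f : V -> R) y v (l : R) :
  open O -> O y -> (forall N x, O x -> derivable (phi N) x v) ->
  (forall x, O x -> phi N x @[N --> \oo] --> f x) ->
  (fun z : V * nat => 'D_v (phi z.2) z.1) @ filter_prod (nbhs y) \oo --> l ->
  is_derive y v f l.
Proof.
move=> oO Oy dphi phif Dl.
suff cv : (fun h => h^-1 *: ((f \o shift y) (h *: v) - f y)) @ 0^' --> l.
  by split; [apply/cvg_ex; exists l|exact: cvg_lim cv].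
apply/cvgrPdist_le => d d0.
have /cvgrPdist_le/(_ _ d0) [[U B] /= [yU [N0 _ N0B]] UB] := Dl.
have : nbhs y (O `&` U) by apply: filterI => //; exact: open_nbhs_nbhs.
have line : (fun h : R => y + h *: v) @ (0 : R) --> y.
  rewrite -[X in _ --> X]addr0 -[X in _ --> _ + X](scale0r v).
  by apply: cvgD; [exact: cvg_cst|apply: cvgZr_tmp; exact: cvg_id].
move=> /line /nbhs_ballP[r /= r0 rB].
near=> h.
have h0 : h != 0 by near: h; exact: nbhs_dnbhs_neq.
have hr : `|h| < r by near: h; exact: dnbhs0_lt.
have small (s : R) : `|s| <= `|h| -> (O `&` U) (y + s *: v).
  by move=> sh; apply: rB; rewrite -ball_normE /= sub0r normrN (le_lt_trans sh).
pose q N := h^-1 * (phi N (y + h *: v) - phi N y).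
have [Oh _] := small h (lexx _).
have qcvg : q N @[N --> \oo] --> h^-1 * (f (y + h *: v) - f y).
  by apply: cvgM; [exact: cvg_cst|apply: cvgB; exact: phif].
have := @closed_cvg _ _ \oo _ (fun N => `|l - q N|) (fun x => x <= d) (@closed_le R d) _
  _ (cvg_norm (cvgB (@cvg_cst _ l _ \oo _) qcvg)).
rewrite /= [h *: v + y]addrC; apply.
exists N0 => // N /= N0N.
have [s sh E] := mvt_line (fun s sh => dphi N _ (small s sh).1).
rewrite /q E mulrA mulVf// mul1r.
by apply: (UB (y + s *: v, N)); split=> /=; [exact: (small s sh).2|exact: N0B].
Unshelve. all: by end_near. Qed.

End LimitDerivative.

(** * Global vector fields from cutoffs, and smoothness of limits tested on them *)

Section Frame.
Context {R : realType} {n : nat} {X : manifold R n}.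
Local Notation e_ i := (delta_mx 0 i : 'rV[R]_n).
Variable chi : X -> X -> R.
Hypothesis chiP : partition_of_unity chi.

(* The partition of unity supplies the cutoffs: chi_q times the j-th coordinate
   field of [chart_at q], extended by 0, is a global smooth vector field. *)
Definition frame_fun (q : X) (j : 'I_n) (p : X) : 'rV[R]_n :=
  chi q p *: 'D_(e_ j) (chart_at p \o chart_inv (chart_at q)) (chart_at q p).

Lemma partition_dom q p : chi q p != 0 -> chart_dom (chart_at q) p.
Proof.
have [_ _ dom _ _] := chiP => cp; apply: dom; exact: subset_closure.
Qed.

Lemma frame_lieR q j W f p : open W -> W p -> chart_dom (chart_at q) p ->
  CmR_on 1 W f ->
  lieR (frame_fun q j) f p =
  chi q p * 'D_(e_ j) (f \o chart_inv (chart_at q)) (chart_at q p).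
Proof.
move=> oW Wp qp Cf.
have D := transition_is_derive_comp (e_ j) (atlas_chart_at p) (atlas_chart_at q)
  (chart_at_dom p) qp oW Wp Cf.
rewrite (@derive_val _ _ _ _ _ _ _ D) /lieR.
have tp : chart_trace (chart_at p) W (chart_at p p).
  by exists p => //; split=> //; exact: chart_at_dom.
have [df dE] := C1_differentiable (open_chart_trace _ oW) tp (Cf _ (atlas_chart_at p)).
rewrite deriveE// dE mulr_sumr; apply: eq_bigr => k _.
by rewrite /frame_fun mxE -mulrA.
Qed.

Lemma chart_coord_smooth m (c : chart R n X) i : atlas c ->
  CmR_on m (chart_dom c) (fun p => c p 0 i).
Proof. by move=> ac d ad; exact: (transition_smooth ad ac i). Qed.

(** Seeing components as Lie derivatives of coordinate functions makes the frame fields accessible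
    to [frame_lieR]. *)
Lemma vf_coord_lieR (c : chart R n X) (xi : X -> 'rV[R]_n) p i :
  atlas c -> chart_dom c p ->
  vf_coord c xi p 0 i = lieR xi (fun p => c p 0 i) p.
Proof.
move=> ac cp; rewrite /vf_coord /lieR.
have d k : derivable (fun z => (c \o chart_inv (chart_at p)) z 0 k) (chart_at p p) (xi p).
  exact: (@lieR_derivable _ _ _ (chart_dom c) (fun p => c p 0 k) p (xi p)
    (@chart_dom_open _ _ _ c) cp (@chart_coord_smooth 1 c k ac)).
by rewrite (derivable_rowP d).2.
Qed.

(** Two open sets cover the chart: off [supp (chi q)] the field is 0, and on the domain of
    [chart_at q] its components are [chi q] times partial derivatives of a transition map. *)
Lemma frame_smooth q j c : atlas c -> forall i : 'I_n,
  Ck_on None (chart_img c) (fun y => vf_coord c (frame_fun q j) (chart_inv c y) 0 i).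
Proof.
move=> ac i m _; have [chi_smooth _ chi_dom _ _] := chiP.
pose a := chart_at q; have aa : atlas a := atlas_chart_at q.
have oc := @chart_dom_open _ _ _ c; have oa := @chart_dom_open _ _ _ a.
apply: Cm_on_local => y cy.
have [sy|sy] := pselect (supp (chi q) (chart_inv c y)); last first.
  have oS : open (~` supp (chi q)) by apply: closed_openC; exact: closed_closure.
  exists (chart_trace c (~` supp (chi q))); first exact/chart_traceP.
  apply: Cm_on_eq (Cm_on_cst m 0 (open_chart_trace c oS)); first exact: open_chart_trace.
  move=> z /chart_traceP[cz zS]; rewrite vf_coord_lieR//; last exact: chart_inv_dom.
  by rewrite /lieR /frame_fun (supp_out zS) scale0r derive0.
exists (chart_trace c (chart_dom a)); first by apply/chart_traceP; split=> //; exact: chi_dom.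
pose f := 'D_(e_ j) (fun z => c (chart_inv a z) 0 i).
have Cf : Cm_on m (chart_trace a (chart_dom c)) f.
  by have [_ /(_ j)[]] := transition_smooth aa ac i (I : order_le m.+1 None).
have Ccomp : Cm_on m (chart_trace c (chart_dom a)) (f \o (a \o chart_inv c)).
  apply: Cm_on_comp Cf; [exact: open_chart_trace|exact: open_chart_trace| |].
    move=> z /chart_traceP[cz az]; exists (chart_inv c z) => //.
    by split=> //; exact: chart_inv_dom.
  by move=> k; exact: (transition_smooth ac aa k).
have Cchi : Cm_on m (chart_trace c (chart_dom a)) (chi q \o chart_inv c).
  by apply: Cm_on_sub (chi_smooth q c ac m I) => z /chart_traceP[].
apply: Cm_on_eq (Cm_on_mul (open_chart_trace c oa) Cchi Ccomp).
  exact: open_chart_trace.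
move=> z /chart_traceP[cz az]; have cpz := chart_inv_dom cz.
by rewrite vf_coord_lieR// (frame_lieR j oc cpz az (@chart_coord_smooth 1 c i ac)).
Qed.

Definition frame q j : vector_field X := VectorField (@frame_smooth q j).

(** Words are lists of labels, so that over finitely many [q] there are only finitely many of a
    given length. *)
Definition frame_word (wd : seq (X * 'I_n)) := [seq frame x.1 x.2 | x <- wd].

Lemma chart_partial_frame q (c : chart R n X) i f y : atlas c -> chart_img c y ->
  chi q (chart_inv c y) != 0 -> CmR 1 f ->
  is_derive y (e_ i) (f \o chart_inv c)
  (\sum_(j < n) ('D_(e_ i) (fun z => chart_at q (chart_inv c z) 0 j) y
     * (chi q (chart_inv c y))^-1) * lieR (frame q j) f (chart_inv c y)).
Proof.
move=> ac cy chi0 Cf; set p := chart_inv c y; have cp := chart_inv_dom cy.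
have qp := partition_dom chi0; have aa := atlas_chart_at q.
have := transition_is_derive_comp (e_ i) aa ac qp cp openT I Cf.
rewrite (chart_invK cy) => D; apply: (is_derive_eq D); apply: eq_bigr => j _.
rewrite (frame_lieR j openT I qp Cf) -mulrA mulKf//; congr (_ * _).
apply: (derivable_rowP (phi := chart_at q \o chart_inv c) _).2 => k.
apply: diff_derivable.
have oT := open_chart_trace c (@chart_dom_open _ _ _ (chart_at q)).
apply: (C1_differentiable oT _ (transition_smooth ac aa k _)).1 => //.
exact/chart_traceP.
Qed.

Section Limit.
Variables (W : set X) (Q : seq X).
Hypothesis oW : open W.
Hypothesis WQ : forall p, W p -> exists2 q, q \in Q & chi q p != 0.

Lemma cconv_limit_continuous (g : nat -> X -> R) (f : X -> R) :
  (forall p, W p -> (fun z : X * nat => g z.2 z.1) @ filter_prod (nbhs p) \oo --> f p) ->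
  (forall p, W p -> {for p, continuous f}) /\
  (forall p, W p -> g N p @[N --> \oo] --> f p).
Proof.
move=> gf; have pw p : W p -> g N p @[N --> \oo] --> f p.
  move=> Wp; apply: cvg_trans (gf p Wp) => A [[U B] /= [pU BB] UB].
  by apply: filterS BB => N BN; apply: (UB (p, N)); split=> //=; exact: nbhs_singleton pU.
split=> // p Wp; apply/cvgrPdist_le => d d0.
have /cvgrPdist_le/(_ _ d0) [[U B] /= [pU BB] UB] := gf p Wp.
have pW : nbhs p W by exact: open_nbhs_nbhs.
apply: filterS (filterI pW pU) => x [Wx Ux].
apply: (@closed_cvg _ _ \oo _ (fun N => `|f p - g N x|) (fun x => x <= d) (@closed_le R d)).
  by apply: filterS BB => N BN; exact: (UB (x, N)).
by apply: cvg_norm; apply: cvgB; [exact: cvg_cst|exact: pw].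
Qed.

(* Where chi_q <> 0, partial derivatives in any chart are combinations of the
   Lie derivatives along [frame q j], with smooth coefficients not depending on
   N; so the derivatives of g N converge in that chart as well. *)
Lemma limit_smooth m (g : nat -> X -> R) (f : X -> R) :
  (forall N k, CmR k (g N)) ->
  (forall wd, all (fun x => x.1 \in Q) wd -> exists h : X -> R, forall p, W p ->
    (fun z : X * nat => lie_iter (frame_word wd) (g z.2) z.1)
      @ filter_prod (nbhs p) \oo --> h p) ->
  (forall p, W p -> (fun z : X * nat => g z.2 z.1) @ filter_prod (nbhs p) \oo --> f p) ->
  CmR_on m W f.
Proof.
elim: m g f => [|m IH] g f Cg gw gf c ac.
  split=> // y /chart_traceP[cy Wy].
  apply: (@continuous_comp _ _ _ (chart_inv c) f).
    exact: chart_inv_continuous.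
  exact: (cconv_limit_continuous gf).1.
have [cf pf] := cconv_limit_continuous gf.
have [chi_smooth _ _ _ _] := chiP.
apply: Cm_on_local => y0 /chart_traceP[cy0 Wy0].
have [q qQ chi0] := WQ Wy0; pose a := chart_at q; have aa : atlas a := atlas_chart_at q.
(* On [W'] one may divide by [chi q]; as [q] was chosen at [y0], the argument is local. *)
pose W' := W `&` [set p | chi q p != 0].
have Cchi k : CmR k (chi q) by move=> d ad; rewrite chart_traceT; exact: chi_smooth.
have oW' : open W'.
  apply: openI => //; apply: (@open_comp _ _ (chi q) [set x | x != 0]).
    by move=> p _; exact: (CmR_continuous (Cchi 0%N)).
  exact: open_neq.
have oO := open_chart_trace c oW'.
exists (chart_trace c W'); first exact/chart_traceP.
have /choice[gam gamP] : forall j : 'I_n, exists h : X -> R, forall p, W p ->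
    (fun z : X * nat => lieR (frame q j) (g z.2) z.1)
      @ filter_prod (nbhs p) \oo --> h p.
  by move=> j; apply: (gw [:: (q, j)]); rewrite /= qQ.
pose b i j z := 'D_(e_ i) (fun z => a (chart_inv c z) 0 j) z * (chi q (chart_inv c z))^-1.
have W'a z : chart_trace c W' z -> chart_trace c (chart_dom a) z.
  by move=> /chart_traceP[cz [_ chiz]]; apply/chart_traceP; split=> //; exact: partition_dom.
have Cb k i j : Cm_on k (chart_trace c W') (b i j).
  apply: Cm_on_mul => //.
    have [_ /(_ i)[_]] := transition_smooth ac aa j (I : order_le k.+1 None).
    by apply: Cm_on_sub => z /W'a.
  apply: Cm_on_inv => //; first by move=> z /chart_traceP[_ []].
  by apply: Cm_on_sub (chi_smooth q c ac k I) => z /chart_traceP[].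
(* Induction applies to the sequence of Lie derivatives along [frame q j]: its words are words of
   [g] with [(q, j)] added as innermost letter. *)
have Cgam j : CmR_on m W (gam j).
  apply: (IH (fun N => lieR (frame q j) (g N))) (gamP j).
    by move=> N k; exact: CmR_lieR.
  move=> wd wdQ; have := gw (rcons wd (q, j)); rewrite all_rcons /= qQ wdQ => /(_ isT).
  move=> [h hP]; exists h => p Wp; have := hP p Wp.
  by rewrite /frame_word map_rcons; under eq_fun do rewrite lie_iter_rcons.
pose psi i z := \sum_(j < n) b i j z * gam j (chart_inv c z).
have Dpsi i z : chart_trace c W' z -> is_derive z (e_ i) (f \o chart_inv c) (psi i z).
  move=> Oz; have dg N x : chart_trace c W' x -> is_derive x (e_ i) (g N \o chart_inv c)
      (\sum_(j < n) b i j x * lieR (frame q j) (g N) (chart_inv c x)).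
    by move=> /chart_traceP[cx [_ chix]]; exact: chart_partial_frame.
  apply: (is_derive_limit (phi := fun N => g N \o chart_inv c) oO Oz).
  - by move=> N x Ox; exact: (@ex_derive _ _ _ _ _ _ _ (dg N x Ox)).
  - by move=> x /chart_traceP[_ [Wx _]]; exact: pf.
  pose G (w : 'rV[R]_n * nat) :=
    \sum_(j < n) b i j w.1 * lieR (frame q j) (g w.2) (chart_inv c w.1).
  have FP : Filter (filter_prod (nbhs z) \oo).
    exact: (@filter_prod_filter _ _ _ _ (nbhs_filter z) _).
  apply: (@cvg_trans _ (G @ filter_prod (nbhs z) \oo)).
    apply: near_eq_cvg; exists (chart_trace c W', setT) => /=.
      by split; [exact: open_nbhs_nbhs|exact: filterT].
    by move=> [x N] /= [Ox _]; rewrite (@derive_val _ _ _ _ _ _ _ (dg N x Ox)).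
  have /chart_traceP[cz [Wz _]] := Oz.
  apply: (@cvg_big R 'I_n +%R 0 xpredT add_continuous _ _ _
    (fun j (w : 'rV[R]_n * nat) => b i j w.1 * lieR (frame q j) (g w.2) (chart_inv c w.1))
    (fun j => b i j z * gam j (chart_inv c z)) FP) => j _.
  apply: cvgM.
    apply: (@cvg_comp _ _ _ fst (b i j) _ (nbhs z)); last first.
      exact: (Cm_on_continuous (Cb 0%N i j) Oz).
    exact: (@cvg_fst _ _ _ _ _).
  have inv : (fun w : 'rV[R]_n * nat => (chart_inv c w.1, w.2))
      @ filter_prod (nbhs z) \oo --> filter_prod (nbhs (chart_inv c z)) \oo.
    move=> A [[U B] /= [zU BB] UB].
    exists (chart_inv c @^-1` U, B) => /=.
      by split=> //; exact: (@chart_inv_continuous _ _ _ c z cz _ zU).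
    by move=> [x N] /= [Ux BN]; exact: (UB (_, _)).
  exact: (@cvg_comp _ _ _ (fun w : 'rV[R]_n * nat => (chart_inv c w.1, w.2))
    (fun w : X * nat => lieR (frame q j) (g w.2) w.1) _ _ _ inv (gamP j _ Wz)).
split.
  move=> z /chart_traceP[cz [Wz _]]; apply: (@continuous_comp _ _ _ (chart_inv c) f).
    exact: chart_inv_continuous.
  exact: cf.
move=> i; split; first by move=> z Oz; exact: (@ex_derive _ _ _ _ _ _ _ (Dpsi i z Oz)).
have : Cm_on m (chart_trace c W') (psi i).
  apply: Cm_on_sum => // j; apply: Cm_on_mul => //.
  by apply: Cm_on_sub (Cgam j c ac) => z /chart_traceP[cz [Wz _]]; exact/chart_traceP.
apply: Cm_on_eq => // z Oz.
by rewrite (@derive_val _ _ _ _ _ _ _ (Dpsi i z Oz)).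
Qed.

End Limit.
End Frame.

(** * Simultaneous conditions on finitely many words *)

Section FilterWords.
Context {I : Type} {F : set_system I} {FF : Filter F}.

Lemma filter_all (T : eqType) (s : seq T) (P : T -> set I) :
  (forall x, F (P x)) -> F [set e | forall x, x \in s -> P x e].
Proof.
move=> FP; elim: s => [|a s IH]; first by apply: filterS (filterT) => e _ x.
apply: filterS (filterI (FP a) IH) => e [Pa Ps] x.
by rewrite inE => /predU1P[-> //|/Ps].
Qed.

(** The words concerned are finite in number, so this is a finite intersection; induction on the
    length, prescribing the first letter, avoids enumerating them. *)
Lemma filter_words (T : eqType) (J : finType) (s : seq T) k
    (P : seq (T * J) -> set I) :
  (forall wd, F (P wd)) ->
  F [set e | forall wd, all (fun x => x.1 \in s) wd -> (size wd <= k)%N -> P wd e].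
Proof.
elim: k P => [|k IH] P FP.
  by apply: filterS (FP [::]) => e Pe wd _; rewrite leqn0 => /nilP ->.
have FS x : F [set e | forall j : J, forall wd, all (fun x => x.1 \in s) wd ->
    (size wd <= k)%N -> P ((x, j) :: wd) e].
  apply: (@filter_forall _ _ (fun (j : J) e => forall wd, all (fun x => x.1 \in s) wd ->
    (size wd <= k)%N -> P ((x, j) :: wd) e)) => j.
  by apply: (IH (fun wd => P ((x, j) :: wd))) => wd; exact: FP.
apply: filterS (filterI (FP [::]) (filter_all s FS)) => e [Pe Pse] [|[x j] wd] //=.
by move=> /andP[xs wds]; rewrite ltnS; exact: Pse.
Qed.

End FilterWords.

Section CauchySequences.
Context {R : realType} {n : nat} {X : manifold R n}.

Lemma uniform_cauchy_limit (a : nat -> X -> R) (L : set X) :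
  (forall N, continuous (a N)) ->
  (forall d, 0 < d -> exists N0, forall N, (N0 <= N)%N ->
     forall p, L p -> `|a N p - a N0 p| <= d) ->
  exists f : X -> R,
    (forall d, 0 < d -> \forall N \near \oo, forall p, L p -> `|f p - a N p| <= d) /\
    forall p, interior L p ->
      (fun z : X * nat => a z.2 z.1) @ filter_prod (nbhs p) \oo --> f p.
Proof.
move=> ca cauchy; exists (fun p => lim (a N p @[N --> \oo])).
have cvga p : L p -> a N p @[N --> \oo] --> lim (a N p @[N --> \oo]).
  move=> Lp; apply/cauchy_cvgP/cauchy_ballP => d d0.
  have d40 : 0 < d / 4 by rewrite divr_gt0.
  have [N0 N0P] := cauchy _ d40.
  exists ([set x : R | `|x - a N0 p| <= d / 4], [set x : R | `|x - a N0 p| <= d / 4]).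
    by split; exists N0 => // N /= N0N; exact: N0P.
  move=> [x y] /= [xN yN]; rewrite -ball_normE /=.
  rewrite -(subrKA (a N0 p)) (le_lt_trans (ler_normD _ _))// [X in _ + X]distrC.
  by move: xN yN; lra.
have unif d : 0 < d -> \forall N \near \oo, forall p, L p ->
    `|lim (a M p @[M --> \oo]) - a N p| <= d.
  move=> d0; have d20 : 0 < d / 2 by rewrite divr_gt0.
  have [N0 N0P] := cauchy _ d20; exists N0 => // N /= N0N p Lp.
  apply: (@closed_cvg _ _ \oo _ (fun M => `|a M p - a N p|) (fun x => x <= d) (@closed_le R d)).
    exists N0 => // M /= N0M; rewrite -(subrKA (a N0 p)) (le_trans (ler_normD _ _))//.
    by rewrite [X in _ + X]distrC (splitr d) lerD// N0P.
  by apply: cvg_norm; apply: cvgB; [exact: cvga|exact: cvg_cst].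
split=> // p pL; apply/cvgrPdist_le => d d0.
(* Four errors: from the limit to [a M] at [p], from [p] to [q] by continuity of [a M], back to the
   limit at [q], and on to [a N] at [q]. *)
have d40 : 0 < d / 4 by rewrite divr_gt0.
have [M _ MP] := unif _ d40.
have /cvgrPdist_le/(_ _ d40) near_p := ca M p.
exists (interior L `&` [set q | `|a M p - a M q| <= d / 4], [set N | (M <= N)%N]) => /=.
  by split; [apply: filterI => //; exact: nbhs_interior|exists M].
move=> [q N] /= [[/interior_subset Lq qp] MN].
have h1 := MP M (leqnn M) p (interior_subset pL).
have h2 := MP M (leqnn M) q Lq; have h3 := MP N MN q Lq.
move: h1 h2 h3 qp; set x := lim _; set y := lim _ => h1 h2 h3 qp.
have := ler_distD (a M p) x (a N q); have := ler_distD (a M q) (a M p) (a N q).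
have := ler_distD y (a M q) (a N q); rewrite [`|a M q - y|]distrC; lra.
Qed.

(** The bound is assumed only from [k0] on because the k-th term will be controlled along words of
    length at most [k]: a given word has to wait for its length. *)
Lemma geometric_cauchy (a : nat -> X -> R) (L : set X) k0 :
  (forall k p, (k0 <= k)%N -> L p -> `|a k.+1 p - a k p| <= (2 ^+ k)^-1) ->
  forall d, 0 < d -> exists N0, forall N, (N0 <= N)%N ->
    forall p, L p -> `|a N p - a N0 p| <= d.
Proof.
move=> geo d d0.
have [N1 _ N1P] : \forall N \near \oo, 2 * (2 ^+ N)^-1 <= d.
  have /cvgrPdist_le/(_ _ d0) : (fun N : nat => 2 * (2 ^+ N)^-1) @ \oo --> (0 : R).
    rewrite -[X in _ --> X](mulr0 2); apply: cvgM; first exact: cvg_cst.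
    under eq_fun do rewrite -exprVn.
    by apply: cvg_expr; rewrite ger0_norm ?invr_ge0// invf_lt1 ?ltr1n.
  by apply: filterS => N; rewrite sub0r normrN ger0_norm// mulr_ge0// invr_ge0 exprn_ge0.
exists (maxn k0 N1) => N /subnK <- p Lp; set m := maxn k0 N1.
apply: le_trans (_ : 2 * (2 ^+ m)^-1 - 2 * (2 ^+ (N - m + m))^-1 <= _); last first.
  rewrite lerBlDr (le_trans (N1P m _))//= ?leq_maxr// lerDl mulr_ge0// invr_ge0 exprn_ge0//.
elim: (N - m)%N => [|t IH]; first by rewrite !subrr normr0.
rewrite addSn -(subrKA (a (t + m)%N p)) (le_trans (ler_normD _ _))//.
have := geo (t + m)%N p (leq_trans (leq_maxl _ _) (leq_addl _ _)) Lp.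
move: IH; rewrite exprS invfM mulrA mulfV// mul1r; lra.
Qed.

End CauchySequences.

(** * Summing humps to a test density *)

Section TestDensities.
Context {R : realType} {s : scalar_kind} {n : nat} {X : manifold R n}.
Local Notation K := (scalars R s).
Implicit Types (mu nu : test_density s X) (f g : Cinf s X).

Lemma dens_mulDr f mu nu : dens_mul f (mu + nu) = dens_mul f mu + dens_mul f nu.
Proof. by apply/val_inj/funext => p; exact: mulrDr. Qed.

Lemma dens_mulDl f g mu : dens_mul (f + g) mu = dens_mul f mu + dens_mul g mu.
Proof. by apply/val_inj/funext => p; exact: mulrDl. Qed.

Lemma dens_mul0l mu : dens_mul 0 mu = 0.
Proof. by apply/val_inj/funext => p; exact: mul0r. Qed.

Lemma dens_mulC f g mu : dens_mul f (dens_mul g mu) = dens_mul g (dens_mul f mu).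
Proof. by apply/val_inj/funext => p; exact: mulrCA. Qed.

Lemma dens_mulA f g mu : dens_mul (f * g) mu = dens_mul f (dens_mul g mu).
Proof. by apply/val_inj/funext => p; rewrite /= mulrA. Qed.

Lemma dens_mul_sum mu (h : nat -> Cinf s X) N :
  \sum_(i < N) dens_mul (h i) mu = dens_mul (\sum_(i < N) h i) mu.
Proof.
elim: N => [|N IH]; first by rewrite !big_ord0 dens_mul0l.
by rewrite !big_ord_recr /= IH dens_mulDl.
Qed.

Lemma integral_dens_mul_dom f mu : exists2 C, 0 <= C &
  forall nu (r : X -> K) M, 0 <= M -> (forall p, nu p = r p * mu p :> K) ->
    (forall p, supp mu p -> kabs (r p) <= M) ->
    kabs (integral_density (dens_mul f nu)) <= C * M.
Proof.
have [C C0 CP] := integral_density_dom (dens_mul f mu).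
exists C => // nu r M M0 nuE rM; apply: CP => // p /=.
rewrite nuE mulrCA kabsM; have [Lp|/supp_out ->] := pselect (supp mu p).
  by apply: ler_wpM2r; [exact: kabs_ge0|exact: rM].
by rewrite mulr0 kabs0 !mulr0.
Qed.

(** Over the reals [kpair] drops its second entry, so the imaginary part of an assembled function
    has to be treated as 0 there. *)
Lemma kim_pair_cases :
  (forall a b : R, kim (kpair s a b) = b) \/ (forall a b : R, kim (kpair s a b) = 0).
Proof. by case: s; [right|left]. Qed.

(** [H] is controlled on [W] only. That is enough, since [W] and the complement of [supp mu] are
    open and cover [X], and the product is 0 on the latter. *)
Lemma mul_density_smooth mu (H : X -> K) (W : set X) : open W -> supp mu `<=` W ->
  (forall m, CmR_on m W (@kre R s \o H)) -> (forall m, CmR_on m W (@kim R s \o H)) ->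
  (fun p => H p * mu p : K^o) \in test_densities (X := X).
Proof.
move=> oW LW Hre Him; have cL := @test_density_compact _ _ _ _ mu.
apply/asboolP; split; last by apply: compact_suppS cL => p ->; rewrite mulr0.
move=> c ac; have smu := @test_density_smooth _ _ _ _ mu c ac.
have oT := open_chart_trace c oW.
have oS : open (~` supp mu) by apply: closed_openC; exact: closed_closure.
have oTS := open_chart_trace c oS.
have restr O k (g : 'rV[R]_n -> K) : O `<=` chart_img c ->
    CkK_on k (chart_img c) g -> CkK_on k O g.
  by move=> Oc [gr gi]; split=> m mk; [exact: Cm_on_sub (gr m mk)|exact: Cm_on_sub (gi m mk)].
have CH : CkK_on None (chart_trace c W) (H \o chart_inv c).
  by split=> m _; [exact: Hre|exact: Him].
have Tc V : chart_trace c V `<=` chart_img c by move=> y /chart_traceP[].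
have [h1 h2] := CkK_on_mul oT CH (restr _ _ _ (Tc W) smu).
have E (proj : K -> R) y : chart_trace c (~` supp mu) y ->
    proj 0 = (proj \o (dens_coord c (fun p => H p * mu p) \o chart_inv c)) y.
  by move=> /chart_traceP[_ yS]; rewrite /= /dens_coord (supp_out yS) !mulr0.
split=> m _; apply: Cm_on_local => y cy.
  have [Sy|Sy] := pselect (supp mu (chart_inv c y)).
    exists (chart_trace c W); first by apply/chart_traceP; split=> //; exact: LW.
    by apply: Cm_on_eq (h1 m I) => // z _ /=; rewrite /dens_coord mulrCA.
  exists (chart_trace c (~` supp mu)); first exact/chart_traceP.
  by apply: Cm_on_eq (Cm_on_cst m (kre (0 : K)) oTS) => // z /E; exact.
have [Sy|Sy] := pselect (supp mu (chart_inv c y)).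
  exists (chart_trace c W); first by apply/chart_traceP; split=> //; exact: LW.
  by apply: Cm_on_eq (h2 m I) => // z _ /=; rewrite /dens_coord mulrCA.
exists (chart_trace c (~` supp mu)); first exact/chart_traceP.
by apply: Cm_on_eq (Cm_on_cst m (kim (0 : K)) oTS) => // z /E; exact.
Qed.

Lemma compact_neighborhood (L : set X) : compact L ->
  exists2 L' : set X, compact L' & L `<=` interior L'.
Proof.
move=> cL; have /choice[V VP] : forall p : X, exists V, compact V /\ nbhs p V.
  by move=> p; have [V cV pV] := locally_compact_manifold p; exists V.
have [|D LD] := @compact_finite_cover X L (fun p => interior (V p)) cL.
  by move=> p; apply: nbhs_interior; exact: (VP p).2.
have [L' cL' DL'] : exists2 L', compact L' & forall z, z \in D -> V z `<=` L'.
  elim: D {LD} => [|z D [L' cL' DL']]; first by exists set0; first exact: compact0.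
  exists (V z `|` L'); first by apply: compactU => //; exact: (VP z).1.
  by move=> x; rewrite inE => /predU1P[-> y|/DL' VL' y Vy]; [left|right; exact: VL'].
by exists L' => // p /LD[z zD]; apply: interiorS; exact: DL'.
Qed.

Section Partition.
Variable chi : X -> X -> R.
Hypothesis chiP : partition_of_unity chi.

Lemma partition_cover (L : set X) : compact L ->
  exists Q : seq X, forall p, L p -> exists2 q, q \in Q & chi q p != 0.
Proof.
move=> cL; have [_ _ _ lf sum1] := chiP.
have /finite_seqP[Q QE] := locally_finite_compact lf cL.
exists Q => p Lp; have [q chiq] : exists q, chi q p != 0.
  apply: contrapT => noq; have := sum1 p; rewrite fsbig1.
    by move/eqP; rewrite eq_sym oner_eq0.
  by move=> q _; apply/eqP; apply: contra_notT noq => h; exists q.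
exists q => //; have : [set q | (supp (chi q) `&` L) !=set0] q.
  by exists p; split=> //; exact: subset_closure.
by rewrite QE.
Qed.

(** A diagonal bound: each fixed word is eventually covered by the condition on its length, so the
    series converges geometrically along every word, and [limit_smooth] applies at every order. *)
Lemma series_limit (proj : K -> R) (h : nat -> Cinf s X) (Q : seq X) (L : set X) :
  (forall x y, proj (x + y) = proj x + proj y) ->
  (forall x, `|proj x| <= kabs x) ->
  (forall xs (g : X -> K), proj \o foldr (@lie R s n X) g xs = lie_iter xs (proj \o g)) ->
  (forall m (g : Cinf s X), CmR m (proj \o g)) ->
  (forall p, interior L p -> exists2 q, q \in Q & chi q p != 0) ->
  (forall k wd, all (fun x => x.1 \in Q) wd -> (size wd <= k)%N -> forall p, L p ->
    kabs (foldr (@lie R s n X) (h k) (frame_word chiP wd) p) <= (2 ^+ k)^-1) ->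
  exists f : X -> R, (forall m, CmR_on m (interior L) f) /\
    (forall d, 0 < d -> \forall N \near \oo, forall p, L p ->
      `|f p - proj ((\sum_(i < N) h i : Cinf s X) p)| <= d).
Proof.
move=> projD projle projlie projC LQ hsmall.
pose g N := proj \o (\sum_(i < N) h i : Cinf s X).
have gS N : g N.+1 = (fun p => g N p + (proj \o h N) p).
  by apply/funext => p; rewrite /g big_ord_recr /= -projD.
have Cg N k : CmR k (g N) by exact: projC.
have words wd : all (fun x => x.1 \in Q) wd -> exists f : X -> R,
    (forall d, 0 < d -> \forall N \near \oo, forall p, L p ->
      `|f p - lie_iter (frame_word chiP wd) (g N) p| <= d) /\
    forall p, interior L p ->
      (fun z : X * nat => lie_iter (frame_word chiP wd) (g z.2) z.1)
        @ filter_prod (nbhs p) \oo --> f p.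
  move=> wdQ.
  apply: (uniform_cauchy_limit (a := fun N => lie_iter (frame_word chiP wd) (g N))).
    by move=> N; apply: lie_iter_continuous.
  apply: (geometric_cauchy (k0 := size wd)) => k p wk Lp.
  rewrite gS (lie_iterD (Cg _ _) (projC _ _)).
  rewrite addrAC subrr add0r -projlie /=.
  by apply: le_trans (projle _) _; exact: hsmall.
have [f [funif fconv]] := words [::] isT; exists f; split=> // m.
apply: (@limit_smooth R n X chi chiP (interior L) Q (open_interior L) LQ m g f Cg _ fconv).
by move=> wd /words[f' [_ f'conv]]; exists f'.
Qed.

(** The witness is [H mu], where [H] is the sum of the [h i] near [supp mu]; what is left after [N]
    terms is [mu] times a factor tending to 0 uniformly on [supp mu]. *)
Lemma summable_densities mu (h : nat -> Cinf s X) (Q : seq X) (L : set X) :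
  supp mu `<=` interior L ->
  (forall p, interior L p -> exists2 q, q \in Q & chi q p != 0) ->
  (forall k wd, all (fun x => x.1 \in Q) wd -> (size wd <= k)%N -> forall p, L p ->
    kabs (foldr (@lie R s n X) (h k) (frame_word chiP wd) p) <= (2 ^+ k)^-1) ->
  exists nu, forall v : Cinf s X,
    integral_density (dens_mul v (nu - \sum_(i < N) dens_mul (h i) mu))
      @[N --> \oo] --> (0 : K).
Proof.
move=> suppL LQ hsmall.
have [Hr [Hr_smooth Hr_lim]] := series_limit kreD kre_le kre_lie_iter
  (fun m g => (Cinf_CmR g m).1) LQ hsmall.
have [Hi [Hi_smooth Hi_lim]] := series_limit kimD kim_le kim_lie_iter
  (fun m g => (Cinf_CmR g m).2) LQ hsmall.
pose H p : K := kpair s (Hr p) (Hi p).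
have Hre m : CmR_on m (interior L) (@kre R s \o H).
  by apply: CmR_on_eq (Hr_smooth m) => [|p _]; [exact: open_interior|rewrite /= kre_pair].
have Him m : CmR_on m (interior L) (@kim R s \o H).
  have oW := open_interior L; have [kimE|kimE] := kim_pair_cases.
    by apply: CmR_on_eq (Hi_smooth m) => // p _; rewrite /= kimE.
  by apply: CmR_on_eq (CmR_on_cst m 0 oW) => // p _; rewrite /= kimE.
pose nu := TestDensity (mul_density_smooth (open_interior L) suppL Hre Him).
exists nu => v; apply/kcvgP => d d0.
have [C C0 CP] := integral_dens_mul_dom v mu.
(* Real and imaginary parts each contribute this much, giving at most [d / 2] after multiplication
   by [C]; [C + 1] is positive even if [C] is 0. *)
have e0 : 0 < d / (C + 1) / 4 by rewrite !divr_gt0// ltr_wpDl.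
apply: filterS (filterI (Hr_lim _ e0) (Hi_lim _ e0)) => N [rN iN].
rewrite subr0 dens_mul_sum.
apply: le_lt_trans (CP _ (fun p => H p - (\sum_(i < N) h i : Cinf s X) p)
  (d / (C + 1) / 4 + d / (C + 1) / 4) _ _ _) _.
- by rewrite addr_ge0// ltW.
- by move=> p; rewrite mulrBl.
- move=> p /suppL/interior_subset Lp.
  rewrite -[X in _ - X]kpair_re_im /H.
  have -> (a b a' b' : R) : kpair s a b - kpair s a' b' = kpair s (a - a') (b - b').
    by apply/eqP; rewrite subr_eq kpairD !subrK.
  apply: le_trans (kabs_pair_le _ _) _; apply: lerD; [exact: rN|exact: iN].
have Cd : C * (d / (C + 1)) <= d.
  by rewrite mulrCA ger_pMr// ler_pdivrMr ?ltr_wpDl// mul1r lerDl.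
set e := d / (C + 1) in Cd *; have -> : C * (e / 4 + e / 4) = C * e / 2 by field.
by move: Cd d0; lra.
Qed.

End Partition.
End TestDensities.

(** * Association *)

Section Association.
Context {R : realType} {s : scalar_kind} {n : nat} {X : manifold R n}.
Local Notation K := (scalars R s).

Lemma eps0_lt (d : R) : 0 < d -> \forall e \near @eps0 R, val e < d.
Proof. by move=> d0; exists d. Qed.

Lemma cvg_eps0 (ee : nat -> @unit_index R) :
  (forall k, val (ee k) < k.+1%:R^-1) -> ee k @[k --> \oo] --> @eps0 R.
Proof.
move=> eek A [eta /= eta0 etaA].
have := near_infty_natSinv_lt (PosNum eta0); apply: filterS => k /= keta.
by apply: etaA; exact: lt_trans (eek k) keta.
Qed.

(** The gliding hump with [Phi e] integration against [v e] and humps [h e] times [mu]. *)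
Lemma integral_mul_cvg0 (h v : net s X) (w : test_density s X -> K) mu :
  (forall mu, integral_density (dens_mul (v e) mu) @[e --> @eps0 R] --> w mu) ->
  (forall xi (L : set X), compact L -> forall d : R, 0 < d ->
    \forall e \near @eps0 R, forall p, L p ->
      kabs (foldr (@lie R s n X) (h e) xi p) < d) ->
  integral_density (dens_mul (v e) (dens_mul (h e) mu)) @[e --> @eps0 R] --> (0 : K).
Proof.
move=> vw hsmall; have eF : Filter (@eps0 R) by exact: filter_filter.
have [chiP|I0] := @chosen_partitionP R s n X; last first.
  by under eq_fun do rewrite I0; exact: cvg_cst.
have [L' cL' suppL'] := compact_neighborhood (@test_density_compact _ _ _ _ mu).
have [Q LQ] := partition_cover chiP cL'.
pose small k e := forall wd : seq (X * 'I_n), all (fun x => x.1 \in Q) wd ->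
  (size wd <= k)%N -> forall p, L' p ->
    kabs (foldr (@lie R s n X) (h e) (frame_word chiP wd) p) < (2 ^+ k)^-1.
(* The first demand makes every admissible sequence of indices tend to 0; the second is the diagonal
   bound that makes its humps summable. *)
pose base k := [set e : @unit_index R | val e < k.+1%:R^-1 /\ small k e].
apply: (@gliding_hump R s _ (@eps0 R) eF (test_density s X)
  (fun e x => integral_density (dens_mul (v e) x)) w (fun e => dens_mul (h e) mu)
  _ vw _ base).
- by move=> e x y; rewrite dens_mulDr integral_densityD.
- move=> e; apply/kcvgP => d d0; have [C C0 CP] := integral_dens_mul_dom (v e) mu.
  have d10 : 0 < d / (C + 1) by rewrite divr_gt0// ltr_wpDl.
  have := hsmall [::] _ (@test_density_compact _ _ _ _ mu) _ d10.
  apply: filterS => e' he'; rewrite subr0.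
  apply: le_lt_trans (CP _ (h e') (d / (C + 1)) (ltW d10) _ _) _ => //.
    by move=> p /he' /ltW.
  by rewrite mulrCA gtr_pMr// ltr_pdivrMr ?ltr_wpDl// mul1r ltrDl.
- move=> k; apply: filterI; first by apply: eps0_lt; rewrite invr_gt0.
  apply: (@filter_words _ (@eps0 R) eF X 'I_n Q k (fun wd e => forall p, L' p ->
    kabs (foldr (@lie R s n X) (h e) (frame_word chiP wd) p) < (2 ^+ k)^-1)).
  by move=> wd; apply: hsmall => //; rewrite invr_gt0 exprn_gt0.
- by move=> ee eeP; apply: cvg_eps0 => k; have [] := eeP k.
move=> ee eeP.
have [|k wd wdQ wk p Lp|nu nuP] := @summable_densities R s n X _ chiP mu
  (fun k => h (ee k)) Q L' suppL'.
- by move=> p /interior_subset; exact: LQ.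
- by apply: ltW; have [_] := eeP k; exact.
by exists nu => e; exact: nuP.
Qed.

Lemma associated_mul (U V : set (net s X)) (w : test_density s X -> K) (f : Cinf s X) :
  associated V w -> U = sigma f \/ Ck_associated None U f ->
  associated (colombeau_mul U V) (distr_mul f w).
Proof.
move=> [v Vv vw] [->|[u Uu uf]].
  (* In case (a) the constant net [f] represents [U], and [f] can be moved onto the density: the
     claim at [mu] is the convergence for [V] at [f mu]. *)
  exists (fun e => f * v e); first by apply: colombeau_mul_rep => //; exact: cl_refl.
  move=> mu; rewrite /distr_mul.
  by under eq_fun do rewrite dens_mulA dens_mulC; exact: vw.
exists (fun e => u e * v e); first exact: colombeau_mul_rep.
move=> mu; have eF : Filter (@eps0 R) by exact: filter_filter.
have hum := @integral_mul_cvg0 (fun e => u e - f) v w mu vw (fun xi => uf xi I).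
have E e : integral_density (dens_mul (u e * v e) mu) =
    integral_density (dens_mul (v e) (dens_mul f mu)) +
    integral_density (dens_mul (v e) (dens_mul (u e - f) mu)).
  rewrite -integral_densityD -dens_mulDr -dens_mulDl [f + _]addrC subrK.
  by rewrite dens_mulA dens_mulC.
under eq_fun do rewrite E.
by have := cvgD (vw (dens_mul f mu)) hum; rewrite addr0; exact.
Qed.

End Association.

Theorem proposition4 (R : realType) (s : scalar_kind) (n : nat)
    (X : manifold R n) (U V : set (net s X))
    (hU : colombeau U) (hV : colombeau V) :
  (forall (w : test_density s X -> scalars R s) (f : Cinf s X),
     is_distribution w -> associated V w ->
     (U = sigma f \/ Ck_associated None U f) ->
     associated (colombeau_mul U V) (distr_mul f w)) /\
  (forall (k : option nat) (f g : X -> scalars R s),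
     Ck k f -> Ck k g ->
     Ck_associated k U f -> Ck_associated k V g ->
     Ck_associated k (colombeau_mul U V) (fun p => f p * g p)).
Proof.
split=> [w f _|k f g]; [exact: associated_mul|exact: Ck_associated_mul].
Qed.
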